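(* Let $(F,G)$ be a Jacobi pair with $m=\deg_yF\ge2$ and $m+n\ge2$, where $n=\deg_yG$; let $p=p(F)$ be its prime degree and $m_0=\deg_xf_0$. (1) If $F,G\in\mathbb C[x,y]$, then $p\ne-1$. (2) If $F,G\in\mathbb C[x^{\pm1},y]$ with $m_0>m$ and $p<0$, then $p\le-1$. Furthermore, if $p=-1$ then $\mathrm{Res}_x(F\,\partial_xG)\ne0$ and $F_{[0]}=x^{m_0}(y-\beta x^{-1})^m$ for some $\beta\in\mathbb C\setminus\{0\}$. Thus, by replacing $y$ by $y+\beta x^{-1}$ for some $\beta\in\mathbb C$ if necessary, one can suppose $p<-1$.
   Context: Bracket: $[F,G]=(\partial_xF)(\partial_yG)-(\partial_yF)(\partial_xG)$. Let $\mathcal A$ be the field of series $f=\sum_{i\in\mathbb Q}f_ix^i$, $f_i\in\mathbb C$, with exponents in $\alpha-\frac1\beta\mathbb Z_+$ for some integers $\alpha,\beta$, $\beta>0$, and $\mathcal B=\mathcal A((y^{-1}))$. Prime degree: for $F=\sum_{i\ge0}f_iy^{m-i}\in\mathcal B$, $f_0\neq0$, $p(F)=p\in\mathbb Q$ if $\deg_xf_i\le\deg_xf_0+pi$ for all $i$ with equality for at least one $i\ge1$; $p(F)=-\infty$ if $F=f_0y^m$; $p(F)=+\infty$ if no such $p$ exists otherwise. A Jacobi pair is a pair $(F,G)$ of elements $F=\sum_{i\ge0}f_iy^{m-i}$, $G=\sum_{j\ge0}g_jy^{n-j}$ of $\mathcal B$, $f_0g_0\ne0$, with $[F,G]\in\mathbb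 C\setminus\{0\}$, $p(F)\neq\pm\infty$ and $p(G)\le p(F)$. (A pair in $\mathbb C[x,y]$ with nonzero constant Jacobian can be brought into this form by exchanging $F$ and $G$ if necessary.) Standing conventions: $m_0=\deg_xf_0\ge0$; $f_0,g_0$ are monic (coefficient of the highest power of $x$ is $1$); $p\ne-\frac{m_0}{m}$ (automatic for polynomials). $F_{[0]}=\sum_{i\ge0}\mathrm{Coeff}(f_i,x^{m_0+ip})\,x^{m_0+ip}y^{m-i}$ is the leading ($0$-th $p$-type) component of $F$. $\mathrm{Res}_x$ denotes the coefficient of $x^{-1}$. *)

(* Defs.v *)
From HB Require Import structures.
From mathcomp Require Import all_boot all_order all_algebra.
From mathcomp Require Import all_classical all_reals.
From mathcomp Require Import complex.

Set Implicit Arguments.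
Unset Strict Implicit.
Unset Printing Implicit Defensive.

Import Order.TTheory GRing.Theory Num.Theory.

Local Open Scope classical_set_scope.
Local Open Scope ring_scope.

(* The complex numbers are R[i] with R : realType.  A series in x is given by
   its coefficient function (f q = coefficient of x^q), a series in x and y by
   F j q = coefficient of x^q y^j.  These types contain arbitrary coefficient
   functions; membership in the field A and in B = A((y^-1)) is expressed by
   in_A and in_B.  The sums over [set: rat] and [set: int] below are sums over
   the support, which is finite for elements of A and B. *)
Definition xseries (R : realType) := rat -> R[i].
Definition xyseries (R : realType) := int -> rat -> R[i].

Definition in_A (R : realType) (f : xseries R) : Prop :=
  exists a b : int, 0 < b /\
    forall q, f q != 0 -> exists k : nat, q = a%:~R - k%:R / b%:~R.

Definition in_B (R : realType) (F : xyseries R) : Prop :=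
  (forall j, in_A (F j)) /\
  (exists N : int, forall j, N < j -> F j = (fun=> 0)).

Definition xmul (R : realType) (f g : xseries R) : xseries R :=
  fun q => \sum_(r \in [set: rat]) f r * g (q - r).

Definition xymul (R : realType) (F G : xyseries R) : xyseries R :=
  fun j q => \sum_(k \in [set: int]) xmul (F k) (G (j - k)) q.

Definition xysub (R : realType) (F G : xyseries R) : xyseries R :=
  fun j q => F j q - G j q.

(* c x^q0 y^j0 *)
Definition xymonom (R : realType) (c : R[i]) (q0 : rat) (j0 : int) :
    xyseries R :=
  fun j q => if (j == j0) && (q == q0) then c else 0.

Definition xyconst (R : realType) (c : R[i]) : xyseries R := xymonom c 0 0.

Definition xypow (R : realType) (F : xyseries R) (k : nat) : xyseries R :=
  iter k (xymul F) (xyconst 1).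

Definition ddx (R : realType) (F : xyseries R) : xyseries R :=
  fun j q => ratr (q + 1) * F j (q + 1).

Definition ddy (R : realType) (F : xyseries R) : xyseries R :=
  fun j q => (j + 1)%:~R * F (j + 1) q.

Definition bracket (R : realType) (F G : xyseries R) : xyseries R :=
  xysub (xymul (ddx F) (ddy G)) (xymul (ddy F) (ddx G)).

Definition resx (R : realType) (F : xyseries R) : int -> R[i] :=
  fun j => F j (- 1).

(* deg_x 0 = -oo; for f != 0 in A the maximum exponent exists. *)
Definition degx (R : realType) (f : xseries R) : \bar rat :=
  xget -oo%E [set d%:E | d in
    [set d : rat | f d != 0 /\ forall q, f q != 0 -> q <= d]].

(* Meaningful for F != 0 in B, where the maximum exponent exists. *)
Definition degy (R : realType) (F : xyseries R) : int :=
  xget 0 [set m : int |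
    F m <> (fun=> 0) /\ forall j, m < j -> F j = (fun=> 0)].

(* The f_i of F = \sum_(i >= 0) f_i y^(m-i), m = deg_y F. *)
Definition ycoef (R : realType) (F : xyseries R) (i : nat) : xseries R :=
  F (degy F - i%:Z).

Definition xmonic (R : realType) (f : xseries R) : Prop :=
  exists d : rat, degx f = d%:E /\ f d = 1.

Definition is_prime_degree (R : realType) (F : xyseries R) (p : rat) : Prop :=
  (forall i : nat,
     (degx (ycoef F i) <= degx (ycoef F 0) + (p * i%:R)%:E)%E) /\
  (exists i : nat, (0 < i)%N /\
     degx (ycoef F i) = (degx (ycoef F 0) + (p * i%:R)%:E)%E).

Definition prime_degree (R : realType) (F : xyseries R) : \bar rat :=
  if `[< forall i : nat, (0 < i)%N -> ycoef F i = (fun=> 0) >] then -oo%E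
  else xget +oo%E [set p%:E | p in is_prime_degree F].

Definition jacobi_pair (R : realType) (F G : xyseries R) : Prop :=
  [/\ in_B F /\ in_B G,
      F <> (fun=> fun=> 0) /\ G <> (fun=> fun=> 0),
      exists c : R[i], c != 0 /\ bracket F G = xyconst c,
      prime_degree F \is a fin_num
    & (prime_degree G <= prime_degree F)%E].

(* F_[0], with p = p(F) and m0 = deg_x f_0. *)
Definition lead_component (R : realType) (F : xyseries R) : xyseries R :=
  fun j q =>
    let p := fine (prime_degree F) in
    let m0 := fine (degx (ycoef F 0)) in
    let i := degy F - j in
    if (0 <= i) && (q == m0 + i%:~R * p) then F j q else 0.

Definition finite_support (R : realType) (F : xyseries R) : Prop :=
  finite_set [set jq : int * rat | F jq.1 jq.2 != 0].

(* F in C[x, y] *)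
Definition is_xypoly (R : realType) (F : xyseries R) : Prop :=
  finite_support F /\
  forall j q, F j q != 0 -> 0 <= j /\ q \is a Num.nat.

(* F in C[x, x^-1, y] *)
Definition is_xlaurent_ypoly (R : realType) (F : xyseries R) : Prop :=
  finite_support F /\
  forall j q, F j q != 0 -> 0 <= j /\ q \is a Num.int.

(* f(x) as a series in x and y *)
Definition of_xseries (R : realType) (f : xseries R) : xyseries R :=
  fun j q => if j == 0 then f q else 0.

(* F(x, Y) = \sum_k F_k(x) Y^k, for F polynomial in y; negative powers of y
   in F would be dropped. *)
Definition subst_y (R : realType) (F Y : xyseries R) : xyseries R :=
  fun j q =>
    \sum_(k \in [set: nat]) xymul (of_xseries (F k%:Z)) (xypow Y k) j q.

(* y + b x^-1 *)
Definition y_plus (R : realType) (b : R[i]) : xyseries R :=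
  fun j q => xymonom 1 0 1 j q + xymonom b (- 1) 0 j q.

(* Main.v *)
(* Put u = 1/x, write F = x^d f(u, y), and let p = -l/N.  In the coordinate
   z = x^(-p) y the leading component of F is x^w P(z), and the bracket becomes
   {F, G} = x F_x G_z - F_z x G_x = c x^(1+p).

   If -1 < p < 0, then m0 > m means w > (1+p) m, so the leading forms of F and G
   commute.  Replacing G repeatedly by G^a - c F^b gives an element whose leading
   form x^v U(z) does not commute with that of F; the resulting equation forces
   eta = P U / S to be a polynomial of degree 1 vanishing at all roots of P.
   Hence P = (z - z0)^m with z0 <> 0, its coefficient at z^(m-1) is nonzero, and
   p is an integer, a contradiction.

   If p = -1, the residue of G dF along z = t is A + c t, because
   d(G dF) = dG dF.  It vanishes at every root t of P: translate t to 0 and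
   follow the Newton polygon of (F, G) below the corner of F.  As long as F has
   positive weight the leading forms commute, so the polygon has an edge with a
   nonzero root, at which one may translate again without changing the residue;
   this ends at weight 0, where the residue is visibly 0.  So P = (z - z0)^m with
   z0 = -A/c, and z0 <> 0 because F_[0] is not a monomial.  For polynomials in
   x and y one has A = 0. *)

Require Import Defs.
From HB Require Import structures.
From mathcomp Require Import all_boot all_order all_algebra.
From mathcomp Require Import all_classical all_reals.
From mathcomp Require Import complex.
From mathcomp Require Import ring lra zify.

Set Implicit Arguments.
Unset Strict Implicit.
Unset Printing Implicit Defensive.

Import Order.TTheory GRing.Theory Num.Theory.

Local Open Scope classical_set_scope.
Local Open Scope ring_scope.

Section Polynomials.
Variable C : numClosedFieldType.
Implicit Types (f g h : {poly {poly C}}) (P Q : {poly C}).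

(** * Brackets in weighted coordinates *)

(* u d/du, where u is the inner variable. *)
Definition theta f : {poly {poly C}} := \poly_(i < size f) ('X * (f`_i)^`()).

Lemma coef_theta f i : (theta f)`_i = 'X * (f`_i)^`().
Proof.
rewrite coef_poly; case: ltnP => // /(nth_default 0) ->.
by rewrite deriv0 mulr0.
Qed.

Lemma thetaD f g : theta (f + g) = theta f + theta g.
Proof. by apply/polyP => i; rewrite !(coefD, coef_theta) derivD mulrDr. Qed.

Lemma thetaN f : theta (- f) = - theta f.
Proof. by apply/polyP => i; rewrite !(coefN, coef_theta) derivN mulrN. Qed.

Lemma thetaM f g : theta (f * g) = theta f * g + f * theta g.
Proof.
apply/polyP => i; rewrite coefD coef_theta !coefM raddf_sum mulr_sumr -big_split.
by apply: eq_bigr => j _; rewrite !coef_theta /= derivM; ring.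
Qed.

Lemma thetaC P : theta P%:P = ('X * P^`())%:P.
Proof.
apply/polyP => i; rewrite coef_theta !coefC.
by case: eqP => // _; rewrite deriv0 mulr0.
Qed.

Lemma theta0 : theta 0 = 0.
Proof. by apply/polyP => i; rewrite coef_theta !coef0 deriv0 mulr0. Qed.

Lemma thetaX : theta 'X = 0.
Proof.
apply/polyP => i; rewrite coef_theta coefX coef0.
by case: eqP => _; rewrite ?deriv0 ?derivC mulr0.
Qed.

Lemma theta_deriv f : theta f^`() = (theta f)^`().
Proof.
apply/polyP => i.
by rewrite !(coef_theta, coef_deriv) derivMn mulrnAr.
Qed.

Lemma theta_exp f k : theta (f ^+ k) = k%:R * f ^+ k.-1 * theta f.
Proof.
case: k => [|k]; first by rewrite expr0 -polyC1 thetaC derivC mulr0 !mul0r.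
elim: k => [|k IH]; first by rewrite expr1 expr0 !mul1r.
by rewrite exprS thetaM IH /= -!natr1 !exprS; ring.
Qed.

Lemma theta_comp f v : theta (f \Po v) = theta f \Po v + (f^`() \Po v) * theta v.
Proof.
elim/poly_ind: f => [|f P IH].
  by rewrite comp_poly0 theta0 deriv0 !comp_poly0 mul0r addr0.
rewrite comp_polyD comp_polyM comp_polyX comp_polyC !thetaD !thetaM IH !thetaC.
rewrite derivMXaddC thetaX !comp_polyD !comp_polyM comp_polyX !comp_polyC mulr0 addr0.
by rewrite ?comp_poly0; ring.
Qed.

(* For F = x^d f(1/x, z) and G = x^e g(1/x, z), this is x^(-d-e) {F, G}. *)
Definition br (d e : int) f g :=
  (d%:~R * f - theta f) * g^`() - f^`() * (e%:~R * g - theta g).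

(** The substitution z -> z + P(u) has Jacobian 1: the terms in which [theta] hits the substituted
    element cancel between the two products. *)
Lemma br_comp d e f g P :
  br d e (f \Po ('X + P%:P)) (g \Po ('X + P%:P)) = br d e f g \Po ('X + P%:P).
Proof.
rewrite /br !theta_comp !deriv_comp derivD derivX derivC addr0 !mulr1.
have compN (n : int) : n%:~R \Po ('X + P%:P) = n%:~R :> {poly {poly C}}.
  exact: rmorph_int.
by rewrite !comp_polyB !comp_polyM !comp_polyB !comp_polyM !compN; ring.
Qed.

Definition u : {poly {poly C}} := 'X%:P.

Lemma theta_u k : theta (u ^+ k) = k%:R * u ^+ k.
Proof.
case: k => [|k]; first by rewrite expr0 mul0r -polyC1 thetaC derivC mulr0.
by rewrite theta_exp /u thetaC derivX mulr1 /= -/u -mulrA -exprSr.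
Qed.

Lemma deriv_u k : (u ^+ k)^`() = 0.
Proof. by rewrite /u -rmorphXn /= derivC. Qed.

(** A factor u^k = x^(-k) is absorbed into x^d, which lowers d by k. *)
Lemma br_u d e k l f g :
  br d e (u ^+ k * f) (u ^+ l * g) = u ^+ (k + l) * br (d - k%:Z) (e - l%:Z) f g.
Proof.
rewrite /br !thetaM !derivM !deriv_u !theta_u exprD !rmorphB /=.
by rewrite -!pmulrn; ring.
Qed.

(** * Divisibility by u and leading forms *)

Lemma u_neq0 k : u ^+ k != 0.
Proof. by rewrite expf_neq0 // polyC_eq0 polyX_eq0. Qed.

Lemma coef_uM k f i : (u ^+ k * f)`_i = 'X^k * f`_i.
Proof. by rewrite /u -rmorphXn /= coefCM. Qed.

Lemma low_coefs_div k P : (forall i, (i < k)%N -> P`_i = 0) ->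
  P = 'X^k * drop_poly k P.
Proof.
move=> P0; rewrite mulrC -[LHS](poly_take_drop k).
suff -> : take_poly k P = 0 by rewrite add0r.
by apply/polyP => i; rewrite coef_take_poly coef0; case: ifP => // /P0.
Qed.

Lemma u_div k f : (forall i j, (j < k)%N -> (f`_i)`_j = 0) ->
  exists h, f = u ^+ k * h.
Proof.
move=> H; exists (\poly_(i < size f) drop_poly k f`_i); apply/polyP => i.
rewrite coef_uM coef_poly; case: ltnP => [_|/(nth_default 0) ->]; last first.
  by rewrite mulr0.
by apply: low_coefs_div => j; exact: H.
Qed.

(** The value at u = 0; when nonzero it is the leading form with respect to x. *)
Definition at0 f : {poly C} := map_poly (horner_eval 0) f.

Lemma coef_at0 f i : (at0 f)`_i = (f`_i)`_0.
Proof. by rewrite coef_map /= horner_evalE horner_coef0. Qed.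

Lemma at0B f g : at0 (f - g) = at0 f - at0 g. Proof. exact: rmorphB. Qed.
Lemma at0M f g : at0 (f * g) = at0 f * at0 g. Proof. exact: rmorphM. Qed.
Lemma at0X f k : at0 (f ^+ k) = at0 f ^+ k. Proof. exact: rmorphXn. Qed.
Lemma at0int (k : int) : at0 k%:~R = k%:~R. Proof. exact: rmorph_int. Qed.
Lemma at0nat (k : nat) : at0 k%:R = k%:R. Proof. exact: rmorph_nat. Qed.
Lemma at0_deriv f : at0 f^`() = (at0 f)^`(). Proof. by rewrite /at0 deriv_map. Qed.
Lemma at0_theta f : at0 (theta f) = 0.
Proof. by apply/polyP => i; rewrite coef_at0 coef_theta coefXM coef0. Qed.
Lemma at0C P : at0 P%:P = (P`_0)%:P.
Proof. by rewrite /at0 map_polyC /= horner_evalE horner_coef0. Qed.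
Lemma at0_u k : at0 (u ^+ k) = (k == 0)%:R.
Proof. by rewrite at0X at0C coefX /= expr0n. Qed.

(** The terms with [theta] carry a factor u, so at u = 0 a Wronskian weighted by d and e remains.
    Leading forms commute when it vanishes. *)
Lemma at0_br d e f g :
  at0 (br d e f g) = d%:~R * at0 f * (at0 g)^`() - e%:~R * (at0 f)^`() * at0 g.
Proof.
by rewrite !(at0B, at0M) !at0int !at0_theta !at0_deriv !subr0; ring.
Qed.

Lemma at0_eq0 f : at0 f = 0 -> exists h, f = u * h.
Proof.
move=> f0; have [|h] := @u_div 1 f; last by rewrite expr1; exists h.
by move=> i [|//] _; rewrite -coef_at0 f0 coef0.
Qed.

(** Every division by u shortens a fixed nonzero coefficient of f, so the process stops. *)
Lemma u_val f : f != 0 -> exists k h, f = u ^+ k * h /\ at0 h != 0.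
Proof.
move=> f0; have [i fi] : exists i, f`_i != 0.
  by exists (size f).-1; rewrite -/(lead_coef f) lead_coef_eq0.
have [n] := ubnP (size f`_i); elim: n f f0 fi => // n IH f f0 fi szf.
have [/at0_eq0[h fh]|] := eqVneq (at0 f) 0; last first.
  by exists 0%N, f; rewrite expr0 mul1r.
have hi : h`_i != 0.
  by apply: contraNneq fi => hi; rewrite fh -[u]expr1 coef_uM hi mulr0.
have [|//||k [h' [hE h'0]]] := IH h.
- by apply: contraNneq hi => ->; rewrite coef0.
- by move: szf; rewrite fh -[u]expr1 coef_uM expr1 mulrC size_mulX.
- by exists k.+1, h'; rewrite exprS -mulrA -hE.
Qed.

(* f(u^N, z u^l) *)
Definition rescale N l f : {poly {poly C}} :=
  \poly_(i < size f) ((f`_i \Po 'X^N) * 'X^(l * i)).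

Lemma coef_rescale N l f i :
  (rescale N l f)`_i = (f`_i \Po 'X^N) * 'X^(l * i).
Proof.
rewrite coef_poly; case: ltnP => // /(nth_default 0) ->.
by rewrite comp_poly0 mul0r.
Qed.

Lemma rescaleD N l f g : rescale N l (f + g) = rescale N l f + rescale N l g.
Proof.
by apply/polyP => i; rewrite !(coefD, coef_rescale) comp_polyD mulrDl.
Qed.

Lemma rescaleB N l f g : rescale N l (f - g) = rescale N l f - rescale N l g.
Proof.
by apply/polyP => i; rewrite !(coefB, coef_rescale) comp_polyB mulrBl.
Qed.

Lemma rescaleM N l f g : rescale N l (f * g) = rescale N l f * rescale N l g.
Proof.
apply/polyP => i; rewrite coef_rescale !coefM raddf_sum mulr_suml.
apply: eq_bigr => -[j /= ji] _; rewrite !coef_rescale comp_polyM.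
have -> : (l * i = l * j + l * (i - j))%N by rewrite -mulnDr subnKC.
by rewrite exprD; ring.
Qed.

Lemma rescaleC N l P : rescale N l P%:P = (P \Po 'X^N)%:P.
Proof.
apply/polyP => i; rewrite coef_rescale !coefC; case: i => [|i] /=.
  by rewrite muln0 mulr1.
by rewrite comp_poly0 mul0r.
Qed.

Lemma rescaleMint N l (k : int) f : rescale N l (k%:~R * f) = k%:~R * rescale N l f.
Proof.
by rewrite rescaleM -!(rmorph_int (@polyC _)) rescaleC comp_polyC.
Qed.

Lemma deriv_rescale N l f : (rescale N l f)^`() = u ^+ l * rescale N l f^`().
Proof.
apply/polyP => i; rewrite coef_uM coef_deriv !coef_rescale coef_deriv.
by rewrite raddfMn /= mulnS exprD mulrnAl mulrnAr; congr (_ *+ _); ring.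
Qed.

Lemma mulX_deriv k : 'X * ('X^k)^`() = k%:R * 'X^k :> {poly C}.
Proof.
rewrite derivXn; case: k => [|k]; first by rewrite mulr0n mulr0 mul0r.
by rewrite mulrnAr -exprS mulr_natl.
Qed.

Lemma theta_rescale N l f :
  theta (rescale N l f) = N%:R * rescale N l (theta f) + l%:R * ('X * (rescale N l f)^`()).
Proof.
apply/polyP => i; rewrite coef_theta coefD.
rewrite -!(rmorph_nat (@polyC {poly C})) !coefCM coefXM !coef_rescale coef_theta.
have -> : (if i == 0%N then 0 else ((rescale N l f)^`())`_i.-1) =
    i%:R * ((f`_i \Po 'X^N) * 'X^(l * i)).
  case: i => [|i] /=; first by rewrite mul0r.
  by rewrite coef_deriv coef_rescale mulr_natl.
rewrite comp_polyM comp_polyX derivM deriv_comp.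
set P := (f`_i)^`() \Po _; set Q := f`_i \Po _.
transitivity (P * ('X * ('X^N)^`()) * 'X^(l * i) + Q * ('X * ('X^(l * i))^`())).
  by ring.
by rewrite !mulX_deriv natrM; ring.
Qed.

(** The chain rule gives N for u d/du and u^l for d/dz; the extra terms with l z d/dz cancel between
    the two products. *)
Lemma br_rescale N l d e f g :
  br (N%:Z * d) (N%:Z * e) (rescale N l f) (rescale N l g)
  = N%:R * u ^+ l * rescale N l (br d e f g).
Proof.
rewrite /br !theta_rescale !rescaleB !rescaleM !rescaleB !rescaleMint !deriv_rescale.
by rewrite !intrM -!pmulrn; ring.
Qed.

(* For n = d + e and P, Q the restrictions of f, g to a constant z, this is the
   residue in x of G dF. *)
Definition ares (d : int) (n : nat) P Q : C := (Q * (d%:~R * P - 'X * P^`()))`_n.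

Lemma ares_rescale N d n P Q : (0 < N)%N ->
  ares (N%:Z * d) (N * n) (P \Po 'X^N) (Q \Po 'X^N) = N%:R * ares d n P Q.
Proof.
move=> N0; rewrite /ares; set a := Q * (d%:~R * _ - _).
have -> : (Q \Po 'X^N) * ((N%:Z * d)%:~R * (P \Po 'X^N) - 'X * (P \Po 'X^N)^`()) =
   N%:R * (a \Po 'X^N).
  have -> : 'X * ((P \Po 'X^N)^`()) = N%:R * (('X * P^`()) \Po 'X^N).
    rewrite deriv_comp comp_polyM comp_polyX mulrCA mulX_deriv; ring.
  rewrite /a !(comp_polyM, comp_polyB) (rmorph_int (@comp_poly _ ('X^N))).
  by rewrite intrM -pmulrn; ring.
rewrite -(rmorph_nat (@polyC _)) coefCM; congr (_ * _).
by rewrite coef_comp_poly_Xn // dvdn_mulr // mulKn.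
Qed.

(** Pulling u^k out of the operator d - u d/du turns d into d - k. *)
Lemma ares_Xn k l d n P Q :
  ares d (k + l + n) ('X^k * P) ('X^l * Q) = ares (d - k%:Z) n P Q.
Proof.
rewrite /ares.
have -> : 'X^l * Q * (d%:~R * ('X^k * P) - 'X * ('X^k * P)^`()) =
  'X^(k + l) * (Q * ((d - k%:Z)%:~R * P - 'X * P^`())).
  have -> : 'X * ('X^k * P)^`() = k%:R * 'X^k * P + 'X^k * ('X * P^`()).
    by rewrite derivM mulrDr mulrA mulX_deriv; ring.
  by rewrite rmorphB /= -pmulrn exprD; ring.
by rewrite coefXnM ltnNge leq_addr /= addKn.
Qed.

Lemma deriv_eq0 P : P^`() = 0 -> P = (P`_0)%:P.
Proof.
move=> P0; apply/polyP => -[|i]; rewrite coefC //=.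
have /eqP := congr1 (fun q : {poly C} => q`_i) P0.
by rewrite coef_deriv coef0 -mulr_natl mulf_eq0 pnatr_eq0 /= => /eqP.
Qed.

Lemma horner_theta f (z : C) : (theta f).[z%:P] = 'X * (f.[z%:P])^`().
Proof.
have := theta_comp f z%:P%:P; rewrite thetaC derivC mulr0 mulr0 addr0.
by rewrite !comp_polyCr thetaC => /polyC_inj.
Qed.

(* The residue of [G dF] along [z = const] varies with [z] at the rate given
   by the bracket, because [d (G dF) = dG dF]. *)
Lemma ares_horner d e n K s f g (z : C) : n%:Z = d + e ->
  br d e f g = (K *: 'X^s)%:P ->
  ares d n f.[z%:P] g.[z%:P] = ares d n f.[0] g.[0] + (s == n)%:R * K * z.
Proof.
move=> nde brK; pose a := g * (d%:~R * f - theta f).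
pose q := map_poly (coefp n) a.
have qE (y : C) : ares d n f.[y%:P] g.[y%:P] = q.[y].
  have -> : q.[y] = (a.[y%:P])`_n.
    rewrite (horner_coef_wide y (size_poly _ _)) horner_coef coef_sum.
    apply: eq_bigr => i _; rewrite coef_map /= -rmorphXn /= mulrC -mulrC.
    by rewrite -[_ * (y ^+ i)%:P]mulrC coefCM mulrC.
  rewrite /ares /a hornerM hornerD hornerN hornerM horner_theta.
  by rewrite -(rmorph_int (@polyC {poly C}) d) hornerC.
have q' : q^`() = ((s == n)%:R * K)%:P.
  have -> : q^`() = map_poly (coefp n) a^`().
    by apply/polyP => i; rewrite coef_deriv !coef_map coef_deriv /= coefMn.
  (* Besides the bracket there remains (n - u d/du) applied to g f', with n = d + e, and this
     operator kills the coefficient of u^n. *)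
  have -> : a^`() = (K *: 'X^s)%:P + ((d + e)%:~R * (g * f^`()) - theta (g * f^`())).
    rewrite -brK /a /br thetaM theta_deriv !derivE.
    have -> : (d%:~R : {poly {poly C}})^`() = 0.
      by rewrite -(rmorph_int (@polyC {poly C})) derivC.
    by rewrite intrD; ring.
  apply/polyP => i; rewrite coef_map /= !coefD coefN coef_theta coefC [RHS]coefC.
  set b := g * _; rewrite -nde -(rmorph_int (@polyC {poly C})) coefCM.
  rewrite -(rmorph_int (@polyC C)) coefCM coefN coefXM coef_deriv.
  have -> : n%:~R * b`_i`_n - (if n == 0 then 0 else b`_i`_n.-1.+1 *+ n.-1.+1) = 0.
    case: n {nde q qE} => [|n] /=; first by rewrite mul0r subr0.
    by rewrite -pmulrn mulr_natl subrr.
  case: ifP => _; rewrite ?coef0 ?addr0 // coefZ coefXn eq_sym.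
  by rewrite mulrC.
have q0 : (q - ((s == n)%:R * K) *: 'X)^`() = 0.
  by rewrite derivB derivZ derivX q' alg_polyC subrr.
have {}q0 := deriv_eq0 q0.
rewrite (qE z) -[0 : {poly C}]polyC0 qE.
have -> : q = (q - ((s == n)%:R * K) *: 'X) + ((s == n)%:R * K) *: 'X by rewrite subrK.
by rewrite {}q0 !hornerE.
Qed.

(** Multiplied by z, both sides begin at z^(a+b), because z d/dz acts on z^a as multiplication by a;
    compare these coefficients. *)
Lemma wronskian_order (d e : int) a b P Q P1 Q1 :
  d%:~R * P * Q^`() = e%:~R * P^`() * Q -> P = 'X^a * P1 -> Q = 'X^b * Q1 ->
  P1.[0] != 0 -> Q1.[0] != 0 -> d * b%:Z = e * a%:Z.
Proof.
move=> W PE QE P0 Q0.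
have: 'X^(a + b) * (d%:~R * P1 * (b%:R * Q1 + 'X * Q1^`()) -
    e%:~R * (a%:R * P1 + 'X * P1^`()) * Q1) = 0.
  transitivity ('X * (d%:~R * P * Q^`() - e%:~R * P^`() * Q)); last first.
    by rewrite W subrr mulr0.
  rewrite PE QE !derivM exprD.
  have -> : 'X * (d%:~R * ('X^a * P1) * (('X^b)^`() * Q1 + 'X^b * Q1^`())
     - e%:~R * (('X^a)^`() * P1 + 'X^a * P1^`()) * ('X^b * Q1)) =
    d%:~R * ('X^a * P1) * ('X * ('X^b)^`() * Q1 + 'X * 'X^b * Q1^`())
     - e%:~R * ('X * ('X^a)^`() * P1 + 'X * 'X^a * P1^`()) * ('X^b * Q1) by ring.
  by rewrite !mulX_deriv; ring.
move/eqP; rewrite mulf_eq0 expf_eq0 polyX_eq0 andbF /= => /eqP /(congr1 (fun p => p.[0])).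
rewrite !(hornerM, hornerD, hornerN, hornerX, hornerC) !mul0r !addr0.
rewrite -!(rmorph_int (@polyC C)) -!(rmorph_nat (@polyC C)) !hornerC => /eqP.
rewrite subr_eq0 => /eqP E; apply/eqP; rewrite -(eqr_int C) !intrM -!pmulrn.
apply/eqP; apply: (mulIf P0); apply: (mulIf Q0).
transitivity (d%:~R * P1.[0] * (b%:R * Q1.[0])); first by ring.
by rewrite E; ring.
Qed.

(** * Newton polygons and descent *)

(* The support of f lies on or above the line of slope s through the point
   u^0 z^a. *)
Definition above f (a : nat) (s : rat) :=
  forall i j, (f`_j)`_i != 0 -> s * a%:R <= i%:R + s * j%:R.

Lemma seq_min (x : rat) (t : seq rat) :
  exists2 y, y \in x :: t & {in x :: t, forall z, y <= z}.
Proof.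
elim: t x => [|y t IH] x; first by exists x; rewrite ?inE // => z; rewrite inE => /eqP->.
have [z zt zmin] := IH y; have [xz|zx] := leP x z.
  exists x; rewrite ?inE ?eqxx // => w; rewrite inE => /predU1P[->//|/zmin].
  exact: le_trans.
exists z; first by rewrite inE zt orbT.
by move=> w; rewrite inE => /predU1P[->|/zmin//]; exact: ltW.
Qed.

(** Lowering the slope about the point (0, a) relaxes the condition at points with j < a; for j >= a
    it holds because i >= 0. *)
Lemma above_le f a s t : 0 <= t -> t <= s -> above f a s -> above f a t.
Proof.
move=> t0 ts H i j /H; have [aj|/ltnW ja] := leqP a j.
  have : (a%:R : rat) <= j%:R by rewrite ler_nat.
  by have : (0 : rat) <= i%:R by []; nra.
have : (j%:R : rat) <= a%:R by rewrite ler_nat.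
by nra.
Qed.

(** t is the minimum of the cap s and of the slopes i / (a - j) of the support points with j < a.
    None of these points has i = 0, so t > 0. *)
Lemma first_slope f a s : 0 < s -> (forall j, (j < a)%N -> (f`_j)`_0 = 0) ->
  exists t, [/\ 0 < t, t <= s, above f a t & t = s \/
    exists i j, [/\ (j < a)%N, (f`_j)`_i != 0 & t * a%:R = i%:R + t * j%:R]].
Proof.
move=> s0 fa.
pose r j := [seq i%:R / (a - j)%:R : rat | i <- iota 0 (size f`_j) & (f`_j)`_i != 0].
pose L := flatten [seq r j | j <- iota 0 a].
have LP z : reflect (exists i j, [/\ (j < a)%N, (f`_j)`_i != 0 &
    z = i%:R / (a - j)%:R]) (z \in L).
  apply: (iffP flatten_mapP) => [[j]|[i [j [ja fij ->]]]].
    rewrite mem_iota add0n /= => ja.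
    by case/mapP => i; rewrite mem_filter => /andP[fij _] ->; exists i, j.
  exists j; first by rewrite mem_iota.
  apply/mapP; exists i => //; rewrite mem_filter fij mem_iota add0n /=.
  by rewrite ltnNge; apply: contraNN fij => /(nth_default 0) ->.
have [t tL tmin] := seq_min s L; exists t; split.
- move: tL; rewrite inE => /predU1P[->//|/LP[i [j [ja fij ->]]]].
  rewrite divr_gt0 ?ltr0n ?subn_gt0 // lt0n; apply: contraNneq fij => ->.
  by rewrite fa.
- by apply: tmin; rewrite inE eqxx.
- have t0 : 0 <= t.
    move: tL; rewrite inE => /predU1P[->|/LP[i [j [ja fij ->]]]]; first exact: ltW.
    by rewrite divr_ge0.
  move=> i j fij; have [aj|ja] := leqP a j.
    have : (a%:R : rat) <= j%:R by rewrite ler_nat.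
    by have : (0 : rat) <= i%:R by []; nra.
  have : t <= i%:R / (a - j)%:R by apply: tmin; rewrite inE; apply/orP; right; apply/LP; exists i, j.
  rewrite ler_pdivlMr ?ltr0n ?subn_gt0 // natrB ?(ltnW ja) //; lra.
- move: tL; rewrite inE => /predU1P[->|/LP[i [j [ja fij tE]]]]; [by left|right].
  exists i, j; split => //; apply/eqP; rewrite -subr_eq -mulrBr.
  by rewrite -natrB ?(ltnW ja) // tE divfK // pnatr_eq0 -lt0n subn_gt0.
Qed.

Lemma above_nat f a l N : (0 < N)%N ->
  above f a (l%:R / N%:R) -> forall i j, (f`_j)`_i != 0 -> (l * a <= N * i + l * j)%N.
Proof.
move=> N0 H i j /H.
have N0' : (0 : rat) < N%:R by rewrite ltr0n.
rewrite mulrAC ler_pdivrMr // mulrDl [l%:R / _ * _]mulrAC divfK ?gt_eqF //.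
by rewrite -!natrM -natrD ler_nat mulnC [(i * N)%N]mulnC.
Qed.

(** All weights N i + l j are at least M, so u^M divides; the points of weight exactly M survive at
    u = 0, which makes [at0 h] the edge polynomial. *)
Lemma rescale_div f M l N : (0 < N)%N ->
  (forall i j, (f`_j)`_i != 0 -> (M <= N * i + l * j)%N) ->
  exists h, [/\ rescale N l f = u ^+ M * h,
    forall j, (f`_j \Po 'X^N) * 'X^(l * j) = 'X^M * h`_j,
    forall i j, (N * i + l * j = M)%N -> (at0 h)`_j = (f`_j)`_i &
    forall j, (at0 h)`_j != 0 -> exists i, (N * i + l * j = M)%N].
Proof.
move=> N0 H; have [|h hE] := @u_div M (rescale N l f).
  move=> j i ila; rewrite coef_rescale coefMXn; case: ltnP => // lji.
  rewrite coef_comp_poly_Xn //; case: ifP => // /dvdnP[k kE].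
  apply/eqP/negPn/negP => /H; rewrite kE mulnK //.
  lia.
exists h; have hE' j : (f`_j \Po 'X^N) * 'X^(l * j) = 'X^M * h`_j.
  by rewrite -coef_rescale hE coef_uM.
have h0 j : (at0 h)`_j = ((f`_j \Po 'X^N) * 'X^(l * j))`_M.
  by rewrite hE' coefXnM ltnn subnn coef_at0.
split => // [i j ij|j].
  rewrite h0 coefMXn -ij ltnNge leq_addl /= addnK.
  by rewrite coef_comp_poly_Xn // dvdn_mulr // mulKn.
rewrite h0 coefMXn; case: ltnP => [_|lj]; first by rewrite eqxx.
rewrite coef_comp_poly_Xn //; case: ifP => [/dvdnP[i iE] _|_]; last by rewrite eqxx.
by exists i; rewrite mulnC -iE subnK.
Qed.

Lemma coef_lt_order a P P1 j : P = 'X^a * P1 -> (j < a)%N -> P`_j = 0.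
Proof. by move=> -> ja; rewrite coefXnM ja. Qed.

Lemma order_split P : P != 0 -> exists a P1, P = 'X^a * P1 /\ P1.[0] != 0.
Proof.
move=> P0; have [a [P1 ]] := multiplicity_XsubC P 0.
by rewrite P0 /= subr0 => P1r ->; exists a, P1; rewrite mulrC.
Qed.

(** Once the power of z is split off, a constant cofactor would make P a monomial, and a nonconstant
    one has a root, necessarily nonzero. *)
Lemma nonmonomial_root a P : P`_a != 0 -> P <> P`_a *: 'X^a ->
  exists2 z, z != 0 & root P z.
Proof.
move=> Pa PnX; have P0 : P != 0 by apply: contraNneq Pa => ->; rewrite coef0.
have [b [Q [PE Q0]]] := order_split P0.
have [sQ|sQ] := eqVneq (size Q) 1%N.
  case: PnX; move/eqP/size_poly1P: sQ => [c c0 QE].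
  have Pc : P = c *: 'X^b by rewrite PE QE mulrC mul_polyC.
  have /eqP ab : a == b.
    move: Pa; rewrite Pc coefZ coefXn mulf_eq0 negb_or pnatr_eq0 eqb0 negbK.
    by case/andP.
  by rewrite {2}Pc coefZ coefXn ab eqxx mulr1.
have [z Qz] : exists z, root Q z by exact/closed_rootP.
exists z; first by apply: contraNneq Q0 => z0; rewrite z0 in Qz.
by rewrite PE rootM Qz orbT.
Qed.

Lemma shift_order a P z : size P = a.+1 -> root P z ->
  exists b Q, [/\ P \Po ('X + z%:P) = 'X^b * Q, Q.[0] != 0, (0 < b <= a)%N &
    b = a -> P = lead_coef P *: ('X - z%:P) ^+ a].
Proof.
move=> sP Pz; have P0 : P != 0 by rewrite -size_poly_gt0 sP.
have [b [Q]] := multiplicity_XsubC P z; rewrite P0 /= => Qz PE.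
have Q0 : Q != 0 by apply: contraNneq Qz => ->; rewrite root0.
have sQ : (size Q + b = a.+1)%N.
  by rewrite -sP PE size_Mmonic ?monic_exp ?monicXsubC // size_exp_XsubC addnS.
have Qgt : (0 < size Q)%N by rewrite size_poly_gt0.
exists b, (Q \Po ('X + z%:P)); split.
- rewrite PE comp_polyM rmorphXn /= comp_polyB comp_polyX comp_polyC addrK.
  by rewrite mulrC.
- by rewrite horner_comp !hornerE.
- rewrite lt0n; apply/andP; split; last by lia.
  apply: contraTneq Pz => b0; by rewrite PE b0 expr0 mulr1.
- move=> ba; have sQ1 : size Q = 1%N by lia.
  have /size_poly1P[c c0 QE] : size Q == 1%N by rewrite sQ1.
  rewrite PE QE ba lead_coefM lead_coefC lead_coef_exp lead_coefXsubC expr1n mulr1.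
  by rewrite mul_polyC.
Qed.

(** For z <> 0 this coefficient is nonzero. It yields a support point on the edge one step in j from
    the corner, which is how slopes are shown to be integers. *)
Lemma coef_exp_XsubC n (z : C) : (('X - z%:P) ^+ n.+1)`_n = - (n.+1%:R * z).
Proof.
elim: n => [|n IH]; first by rewrite expr1 coefB coefX coefC /= sub0r mul1r.
rewrite exprS mulrBl coefB coefXM coefCM /= IH.
have -> : (('X - z%:P) ^+ n.+1)`_n.+1 = 1.
  have /monicP := monic_exp n.+1 (monicXsubC z).
  by rewrite lead_coefE size_exp_XsubC.
by rewrite mulr1 -[n.+2%:R]natr1; ring.
Qed.

Lemma comp_shift0 f (z : C) : (f \Po ('X + z%:P%:P))`_0 = f.[z%:P].
Proof. by rewrite -horner_coef0 horner_comp !hornerE. Qed.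

Lemma at0_shift f (z : C) : at0 (f \Po ('X + z%:P%:P)) = at0 f \Po ('X + z%:P).
Proof. by rewrite /at0 map_comp_poly rmorphD /= map_polyX map_polyC /= horner_evalE hornerC. Qed.

(** z^a is an eigenvector of z d/dz, so the relation becomes d z Q' = e a Q and can be read off
    coefficient by coefficient. *)
Lemma monomial_commute (d e a : nat) (al : C) Q : (0 < d)%N -> al != 0 ->
  d%:Z%:~R * (al *: 'X^a) * Q^`() = e%:Z%:~R * (al *: 'X^a)^`() * Q ->
  forall j, Q`_j != 0 -> (d * j = e * a)%N.
Proof.
move=> d0 al0 W j Qj.
have: 'X^a * (d%:R * ('X * Q^`()) - (e * a)%:R * Q) = 0.
  have := congr1 (fun p => 'X * p) W.
  rewrite !derivZ -!mul_polyC -!pmulrn => W'.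
  have al0' : al%:P != 0 by rewrite polyC_eq0.
  apply: (mulfI al0'); rewrite mulr0; apply/eqP.
  have -> : al%:P * ('X^a * (d%:R * ('X * Q^`()) - (e * a)%:R * Q)) =
    'X * (d%:R * (al%:P * 'X^a) * Q^`()) - (al%:P * e%:R) * (a%:R * 'X^a) * Q.
    by rewrite natrM; ring.
  by rewrite W' -(mulX_deriv a) subr_eq0; apply/eqP; ring.
move/eqP; rewrite mulf_eq0 expf_eq0 polyX_eq0 andbF /= => /eqP E.
have /(congr1 (fun p : {poly C} => p`_j)) := E.
rewrite coefB -!(rmorph_nat (@polyC C)) !coefCM coefXM coef0.
have -> : (if j == 0%N then 0 else Q^`()`_j.-1) = j%:R * Q`_j.
  by case: j {Qj} => [|j] /=; rewrite ?mul0r // coef_deriv mulr_natl.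
rewrite mulrA -mulrBl => /eqP; rewrite mulf_eq0 (negbTE Qj) orbF subr_eq0 -natrM.
by rewrite eqr_nat => /eqP.
Qed.

Lemma slope_eq l N i j a : (0 < N)%N ->
  l%:R / N%:R * a%:R = i%:R + l%:R / N%:R * j%:R :> rat ->
  (N * i + l * j = l * a)%N.
Proof.
move=> N0; have N0' : (N%:R : rat) != 0 by rewrite pnatr_eq0 -lt0n.
move/(congr1 ( *%R N%:R)); rewrite mulrDr !mulrA [N%:R * l%:R]mulrC !mulfK //.
by rewrite -!natrM -natrD => /eqP; rewrite eqr_nat => /eqP ->.
Qed.

Lemma rat_slope (t : rat) : 0 < t -> exists l N,
  [/\ (0 < l)%N, (0 < N)%N, coprime l N & t = l%:R / N%:R].
Proof.
move=> t0; exists `|numq t|%N, `|denq t|%N.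
have n0 : 0 < numq t by rewrite numq_gt0.
split; rewrite ?absz_gt0 ?gt_eqF ?denq_gt0 //; first exact: coprime_num_den.
by rewrite !pmulrn !gez0_abs ?ltW ?denq_gt0 // divq_num_den.
Qed.

(* Puiseux descent: along the first edge of the Newton polygon below the
   corner (d, a) the leading forms still commute, so the edge polynomial of f
   has a nonzero root; shifting it to 0 lowers a, or keeps a, in which case
   the slope is an integer, and lowers d. *)
Lemma descent a d f g e L K P1 : (0 < d)%N -> (0 < e)%N ->
  br d e f g = (K *: 'X^(d + e + L))%:P ->
  at0 f = 'X^a * P1 -> P1.[0] != 0 -> (0 < a)%N -> at0 g != 0 ->
  ares d (d + e) f`_0 g`_0 = 0.
Proof.
elim/ltn_ind: a d f g e L K P1 => a IHa d.
elim/ltn_ind: d => d IHd f g e L K P1 d0 e0 brK fa P10 a0 g0.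
have [b [Q1 [gb Q10]]] := order_split g0.
have br0 n (k l : nat) (c : C) p q : (0 < n)%N -> br k l p q = (c *: 'X^n)%:P ->
    k%:~R * at0 p * (at0 q)^`() = l%:~R * (at0 p)^`() * at0 q.
  move=> n0 /(congr1 (at0)); rewrite at0_br at0C coefZ coefXn.
  by rewrite eq_sym (gtn_eqF n0) mulr0 => /eqP; rewrite subr_eq0 => /eqP.
have W := br0 _ _ _ _ _ _ (_ : (0 < d + e + L)%N) brK.
have {W} dbea := wronskian_order (W _) fa gb P10 Q10.
have {dbea}: (d * b = e * a)%N by have := dbea ltac:(lia); lia.
move=> dbea.
have b0 : (0 < b)%N by nia.
have fj j : (j < a)%N -> (f`_j)`_0 = 0 by move=> ?; rewrite -coef_at0 (coef_lt_order fa).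
have gj j : (j < b)%N -> (g`_j)`_0 = 0 by move=> ?; rewrite -coef_at0 (coef_lt_order gb).
have s0 : 0 < d%:R / a%:R :> rat by rewrite divr_gt0 ?ltr0n.
(* The cap d / a is the slope at which N d - l a vanishes. [t1] is the first slope for f, [t] the
   first one for f and g together. *)
have [t1 [t10 t1s ft1 t1E]] := first_slope s0 fj.
have [t [t0 tt1 gt tE]] := first_slope t10 gj.
have ft : above f a t by apply: above_le ft1 => //; exact: ltW.
have [l [N [l0 N0 lN tlN]]] := rat_slope t0.
rewrite tlN in ft gt.
have [h [hE hc h0 _]] := rescale_div N0 (above_nat N0 ft).
have [k [kE kc k0 _]] := rescale_div N0 (above_nat N0 gt).
have lad : (l * a <= N * d)%N.
  have : l%:R / N%:R <= d%:R / a%:R :> rat by rewrite -tlN (le_trans tt1).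
  by rewrite ler_pdivrMr ?ltr0n // mulrAC ler_pdivlMr ?ltr0n // -!natrM ler_nat [(d * N)%N]mulnC.
have lbe : (l * b <= N * e)%N by nia.
(* The degrees after rescaling and removal of u^(l a) and u^(l b); d b = e a keeps them in the
   proportion d : e. *)
pose d' := (N * d - l * a)%N; pose e' := (N * e - l * b)%N.
have de' : (d * e' = e * d')%N by rewrite /d' /e' !mulnBr; nia.
have brK' : br d' e' h k = ((N%:R * K) *: 'X^(d' + e' + (N * L + l)))%:P.
  apply: (mulfI (u_neq0 (l * a + l * b))).
  have -> : d'%:Z = N%:Z * d - (l * a)%:Z by rewrite /d'; lia.
  have -> : e'%:Z = N%:Z * e - (l * b)%:Z by rewrite /e'; lia.
  rewrite -br_u -hE -kE br_rescale brK rescaleC comp_polyZ rmorphXn /= comp_polyX.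
  rewrite -exprM /u -!rmorphXn /= -!mul_polyC !rmorphM /= !rmorph_nat.
  rewrite !rmorphXn /=.
  have -> : N%:R * 'X%:P ^+ l * (K%:P%:P * 'X%:P ^+ (N * (d + e + L))) =
    N%:R * K%:P%:P * 'X%:P ^+ (l + N * (d + e + L)) :> {poly {poly C}}.
    by rewrite exprD; ring.
  rewrite mulrCA -exprD; congr (_ * _ ^+ _).
  by rewrite /d' /e'; lia.
have aresE : ares d' (d' + e') h`_0 k`_0 = N%:R * ares d (d + e) f`_0 g`_0.
  rewrite -ares_rescale //.
  have := hc 0%N; have := kc 0%N; rewrite !muln0 !expr0 !mulr1 => -> ->.
  have -> : (N * (d + e) = l * a + l * b + (d' + e'))%N by rewrite /d' /e'; lia.
  by rewrite ares_Xn; congr (ares _ _ _ _); rewrite /d'; lia.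
have NC : (N%:R : C) != 0 by rewrite pnatr_eq0 -lt0n.
apply/eqP; rewrite -(mulrI_eq0 _ (mulfI NC)) -aresE; apply/eqP.
(* In degree 0 the residue is the constant coefficient of - u P' Q, hence 0. *)
have [d'0|d'0] := posnP d'.
  have e'0 : e' = 0%N by apply/eqP; rewrite -(eqn_pmul2l d0) muln0 de' d'0 muln0.
  by rewrite /ares d'0 e'0 mul0r sub0r mulrN coefN mulrCA coefXM oppr0.
have e'0 : (0 < e')%N by rewrite -(ltn_pmul2l d0) muln0 de' muln_gt0 e0.
pose P := at0 h; pose Q := at0 k.
have W : d'%:~R * P * Q^`() = e'%:~R * P^`() * Q by apply: br0 brK'; rewrite !addn_gt0 d'0.
have Pa : P`_a = P1.[0].
  rewrite /P (h0 0%N a) ?muln0 // -coef_at0 fa coefXnM ltnn subnn.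
  by rewrite horner_coef0.
have Qb : Q`_b = Q1.[0].
  rewrite /Q (k0 0%N b) ?muln0 // -coef_at0 gb coefXnM ltnn subnn.
  by rewrite horner_coef0.
have high f' h' a' (j : nat) : (forall j, (f'`_j \Po 'X^N) * 'X^(l * j) = 'X^(l * a') * h'`_j) ->
    (a' < j)%N -> (at0 h' : {poly C})`_j = 0.
  move=> /(_ j) H aj; rewrite coef_at0.
  have /(congr1 (fun p : {poly C} => p`_(l * a'))) := H.
  by rewrite coefMXn coefXnM ltnn subnn ltn_pmul2l // aj => <-.
have Ph j : (a < j)%N -> P`_j = 0 by exact: high hc.
have Pa0 : P`_a != 0 by rewrite Pa.
have sP : size P = a.+1.
  apply/anti_leq; rewrite -[(a < _)%N]negbK -leqNgt andbC; apply/andP; split.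
    by apply: contraNN Pa0 => /(nth_default 0) ->.
  by apply/leq_sizeP => j /Ph.
(* If P were a monomial, commuting would leave Q supported at b alone. But the slope t comes from a
   point of g with j < b, from a point of f with j < a, or from the cap, where d' = 0; each case is
   excluded. *)
have PnX : P <> P`_a *: 'X^a.
  move=> PX; have Wj := @monomial_commute d' e' a _ Q d'0 Pa0; rewrite -PX in Wj.
  have {}Wj := Wj W.
  have Wb : (d' * b = e' * a)%N by apply: Wj; rewrite Qb.
  case: tE => [tt|[i [j [jb gij]]]]; last first.
    rewrite tlN => /(slope_eq N0) ij.
    have Qj : Q`_j != 0 by rewrite /Q (k0 i).
    have := Wj _ Qj; rewrite -Wb => /eqP; rewrite eqn_pmul2l // => /eqP jE.
    by rewrite jE ltnn in jb.
  case: t1E => [t1E|[i [j [ja fij]]]].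
    have : (N * d = l * a)%N.
      have aQ : (a%:R : rat) != 0 by rewrite pnatr_eq0 -lt0n.
      have NQ : (N%:R : rat) != 0 by rewrite pnatr_eq0 -lt0n.
      have /eqP : l%:R / N%:R = d%:R / a%:R :> rat by rewrite -tlN tt t1E.
      rewrite eqr_div // -!natrM eqr_nat => /eqP ->; exact: mulnC.
    by move=> Nd; move: d'0; rewrite /d' Nd subnn.
  rewrite -tt tlN => /(slope_eq N0) ij; move: fij; rewrite -(h0 i j ij) -/P PX.
  by rewrite coefZ coefXn (ltn_eqF ja) mulr0 eqxx.
have [z z0 Pz] := nonmonomial_root Pa0 PnX.
have [a' [P2 [P2E P20 /andP[a'0 a'a] a'eq]]] := shift_order sP Pz.
pose s := 'X + z%:P%:P : {poly {poly C}}.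
have brS : br d' e' (h \Po s) (k \Po s) = (N%:R * K *: 'X^(d' + e' + (N * L + l)))%:P.
  by rewrite br_comp brK' comp_polyC.
have kS : at0 (k \Po s) != 0.
  rewrite at0_shift comp_poly2_eq0 ?size_XaddC //.
  by apply: contraNneq Q10; rewrite -/Q -Qb => ->; rewrite coef0.
have aresS : ares d' (d' + e') (h \Po s)`_0 (k \Po s)`_0 =
    ares d' (d' + e') h`_0 k`_0.
  rewrite !comp_shift0 (ares_horner z _ brK') // !horner_coef0.
  (* The exponent of u in the bracket exceeds d' + e', so the residue is the same along every line z
     = const. *)
  have -> : (d' + e' + (N * L + l) == d' + e')%N = false.
    by rewrite -[X in _ == X]addn0 eqn_add2l addn_eq0 (gtn_eqF l0) andbF.
  by rewrite !mul0r addr0.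
rewrite -aresS; have hS : at0 (h \Po s) = 'X^a' * P2 by rewrite at0_shift.
have [a'lt|] := ltnP a' a; first exact: (IHa _ a'lt _ _ _ _ _ _ _ d'0 e'0 brS hS).
move=> aa'; have {a'a aa'} a'E : a' = a by apply/anti_leq/andP.
rewrite a'E in hS; apply: (IHd _ _ _ _ _ _ _ _ d'0 e'0 brS hS) => //.
(* If a does not drop, P is a multiple of (X - z)^a, and its coefficient at X^(a-1) comes from a
   term u^i z^(a-1) of f with N i = l. As l and N are coprime, N = 1, and d' = d - l a < d. *)
suff N1 : N = 1%N by rewrite /d' N1 mul1n ltn_subrL muln_gt0 l0 a0.
apply/eqP; rewrite -dvdn1 -(eqP lN) dvdn_gcd dvdnn andbT.
have : P`_a.-1 != 0.
  rewrite (a'eq a'E) coefZ -(prednK a0) coef_exp_XsubC mulf_neq0 //.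
    by rewrite lead_coef_eq0 -size_poly_gt0 sP.
  by rewrite oppr_eq0 mulf_neq0 // pnatr_eq0.
rewrite /P coef_at0.
have /(congr1 (fun p : {poly C} => p`_(l * a))) := hc a.-1.
rewrite coefMXn coefXnM ltnn subnn ltn_pmul2l // ltnNge leq_pred /= => <-.
rewrite -mulnBr -subn1 subKn // muln1 coef_comp_poly_Xn //.
by case: ifP => //; rewrite eqxx.
Qed.

(** * Elements whose leading form does not commute *)

Lemma deriv_shift P (z : C) : (P \Po ('X + z%:P))^`() = P^`() \Po ('X + z%:P).
Proof. by rewrite deriv_comp derivD derivX derivC addr0 mulr1. Qed.

Lemma shift_split P (z : C) : P != 0 ->
  exists a P1, [/\ P \Po ('X + z%:P) = 'X^a * P1, P1.[0] != 0 & root P z = (0 < a)%N].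
Proof.
move=> P0; have [|a [P1 [PE P1n]]] := @order_split (P \Po ('X + z%:P)).
  by rewrite comp_poly2_eq0 ?size_XaddC.
exists a, P1; split => //.
have -> : root P z = ((P \Po ('X + z%:P)).[0] == 0).
  by rewrite horner_comp !hornerE.
rewrite PE hornerM hornerXn expr0n; case: a {PE} => [|a] /=.
  by rewrite mul1r (negbTE P1n).
by rewrite mul0r eqxx.
Qed.

(** At a point z with Q(z) <> 0, the difference D = P - (P(z)/Q(z)) Q vanishes and satisfies the
    same relation with Q; if D were nonzero, [wronskian_order] would give D and Q the same order
    there. *)
Lemma wronskian_prop P Q : Q != 0 -> P^`() * Q = P * Q^`() -> exists c, P = c *: Q.
Proof.
move=> Q0 W; have [z Qz] : exists z, ~~ root Q z by exact/closed_nonrootP.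
exists (P.[z] / Q.[z]); apply/eqP; rewrite -subr_eq0; apply/negPn/negP => D0.
set D := P - _ in D0.
have [a [D1 [DE D10 Dr]]] := shift_split z D0.
have [b [Q1 [QE Q10 Qr]]] := shift_split z Q0.
have Dz : root D z by rewrite /root /D hornerD hornerN hornerZ divfK ?subrr.
rewrite (negbTE Qz) in Qr; rewrite Dz in Dr.
have : (1%:Z)%:~R * (D \Po ('X + z%:P)) * (Q \Po ('X + z%:P))^`() =
  (1%:Z)%:~R * (D \Po ('X + z%:P))^`() * (Q \Po ('X + z%:P)).
  rewrite !mul1r !deriv_shift -!comp_polyM; congr (_ \Po _).
  by rewrite /D derivB derivZ -!mul_polyC !mulrBl W; ring.
by move=> E; have := wronskian_order E DE QE D10 Q10; lia.
Qed.

(** Orders at a root of P show g >= 0; then U^w and P^g have the same logarithmic derivative. *)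
Lemma commute_power (w : nat) (g : int) P U : (0 < w)%N -> (1 < size P)%N -> U != 0 ->
  w%:R * P * U^`() = g%:~R * P^`() * U ->
  exists k c, g = k%:Z /\ U ^+ w = c *: P ^+ k.
Proof.
move=> w0 sP U0 W; have P0 : P != 0 by rewrite -size_poly_gt0 ltnW.
have [z Pz] : exists z, root P z by apply/closed_rootP; rewrite neq_ltn sP orbT.
have [a [P1 [PE P10 Pr]]] := shift_split z P0.
have [b [U1 [UE U10 _]]] := shift_split z U0.
rewrite Pz in Pr.
have E : w%:Z * b%:Z = g * a%:Z.
  apply: (wronskian_order _ PE UE P10 U10).
  rewrite !deriv_shift -!pmulrn.
  have := congr1 (comp_poly ('X + z%:P)) W.
  by rewrite !comp_polyM rmorph_nat rmorph_int.
case: g W E => [k|k] W E; last by nia.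
exists k; have [||c Uc] := @wronskian_prop (U ^+ w) (P ^+ k).
- by rewrite expf_neq0.
- rewrite !deriv_exp; case: k W {E} => [|k] W.
    rewrite mulr0n mulr0 expr0 mulr1 in W *.
    have : P * U^`() = 0.
      have w0' : (w%:R : {poly C}) != 0.
        by rewrite -(rmorph_nat (@polyC C)) polyC_eq0 pnatr_eq0 -lt0n.
      by apply: (mulfI w0'); rewrite mulr0 mulrA W !mul0r.
    by move/eqP; rewrite mulf_eq0 (negbTE P0) /= => /eqP ->; rewrite mul0r mul0rn.
  rewrite -[_ *+ w]mulr_natl -[_ *+ k.+1]mulr_natl /=.
  transitivity (U ^+ w.-1 * P ^+ k * (w%:R * P * U^`())).
    by rewrite exprS; ring.
  by rewrite W -pmulrn -{2}(prednK w0) exprS; ring.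
by exists c.
Qed.

(** The relation prescribes the logarithmic derivative of U as k / w times that of P, so these
    numbers add under products. *)
Lemma commute_mul w k l P U V : w%:R * P * U^`() = k%:R * P^`() * U ->
  w%:R * P * V^`() = l%:R * P^`() * V ->
  w%:R * P * (U * V)^`() = (k + l)%:R * P^`() * (U * V).
Proof.
move=> EU EV; rewrite derivM mulrDr mulrA EU mulrCA EV natrD; ring.
Qed.

Lemma commute_exp w k P U i : w%:R * P * U^`() = k%:R * P^`() * U ->
  w%:R * P * (U ^+ i)^`() = (i * k)%:R * P^`() * U ^+ i.
Proof.
move=> E; elim: i => [|i IH]; first by rewrite expr0 (derivC (1 : C)) mul0r mulr0 !mul0r.
by rewrite exprS mulSn; exact: commute_mul.
Qed.

Lemma br_exp d e f g k :
  br d (k%:Z * e) f (g ^+ k) = k%:R * g ^+ k.-1 * br d e f g.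
Proof.
case: k => [|k].
  rewrite /br !expr0 (derivC (1 : {poly C})) (thetaC (1 : {poly C})).
  by rewrite (derivC (1 : C)) mul0r; ring.
rewrite /br theta_exp deriv_exp intrM -pmulrn /= -mulr_natl -/(g ^+ k) exprS; ring.
Qed.

Lemma br_self d k f : br d (k%:Z * d) f (f ^+ k) = 0.
Proof. by rewrite br_exp /br; ring. Qed.

Lemma brB d e f g h : br d e f (g - h) = br d e f g - br d e f h.
Proof. by rewrite /br derivB thetaD thetaN; ring. Qed.

Lemma brZ d e f g (c : C) : br d e f (c%:P%:P * g) = c%:P%:P * br d e f g.
Proof.
by rewrite /br thetaM thetaC derivM !derivC mulr0 polyC0; ring.
Qed.

(* Replacing the second entry h by h ^ w - c f ^ k, with c chosen to cancel the
   leading form, decreases the defect delta until the leading forms no longer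
   commute; the leading form of the bracket stays a "power" of that of f. *)
Lemma noncommuting (w : nat) f (kappa sigma delta : nat) (g : int) h s :
  (0 < w)%N -> (1 < size (at0 f))%N -> at0 h != 0 -> at0 s != 0 ->
  w%:R * at0 f * (at0 s)^`() = sigma%:R * (at0 f)^`() * at0 s ->
  w%:Z + g = (delta + kappa + sigma)%:Z ->
  br w g f h = u ^+ delta * s ->
  exists (tau : nat) U S, [/\ S != 0, w%:R * at0 f * S^`() = tau%:R * (at0 f)^`() * S &
    w%:R * at0 f * U^`() - ((kappa + tau)%:Z - w%:Z)%:~R * (at0 f)^`() * U = S].
Proof.
move=> w0 sf; set P := at0 f.
elim/ltn_ind: delta sigma g h s => delta IH sigma g h s h0 s0 sW gE brE.
have E0 : w%:R * P * (at0 h)^`() - g%:~R * P^`() * at0 h = (delta == 0%N)%:R * at0 s.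
  by have := congr1 (at0) brE; rewrite at0_br at0M at0_u.
have [d0|dgt] := posnP delta.
  exists sigma, (at0 h), (at0 s); split => //.
  move: E0; rewrite d0 eqxx mul1r => <-; congr (_ - _%:~R * _ * _); lia.
rewrite (gtn_eqF dgt) mul0r in E0; move/eqP: E0; rewrite subr_eq0 => /eqP E0.
have [k [c [gk hc]]] := commute_power w0 sf h0 E0.
(* The leading forms of h^w and c f^k cancel. Since f commutes with its powers, the bracket with f
   only gains the factor w h^(w-1). *)
pose h' := h ^+ w - c%:P%:P * f ^+ k.
have brh' : br w (w%:Z * g) f h' = u ^+ delta * (w%:R * h ^+ w.-1 * s).
  rewrite /h' brB brZ br_exp brE.
  have -> : w%:Z * g = k%:Z * w%:Z by lia.
  by rewrite br_self; ring.
have hs0 : at0 (w%:R * h ^+ w.-1 * s) != 0.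
  rewrite !at0M at0X at0nat !mulf_neq0 ?expf_neq0 //.
  by rewrite -(rmorph_nat (@polyC C)) polyC_eq0 pnatr_eq0 -lt0n.
have at00 : at0 (0 : {poly {poly C}}) = 0 by exact: rmorph0.
have h'0 : h' != 0.
  apply: contraNneq hs0 => h'0.
  have := brh'; rewrite h'0.
  have -> : br w (w%:Z * g) f 0 = 0 by rewrite /br theta0 deriv0; ring.
  move/esym/eqP; rewrite mulf_eq0 (negbTE (u_neq0 _)) /=.
  by move=> /eqP ->; rewrite at00.
have [j [h2 [h'E h20]]] := u_val h'0.
have j0 : (0 < j)%N.
  rewrite lt0n; apply: contraNneq h20 => j0; have := congr1 (at0) h'E.
  rewrite j0 mul1r /h' at0B at0M !at0X hc at0C coefC /= -/P mul_polyC subrr.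
  by move=> <-.
have br2 : u ^+ j * br w (w%:Z * g - j%:Z) f h2 = u ^+ delta * (w%:R * h ^+ w.-1 * s).
  by rewrite -brh' h'E -{2}[f]mul1r -(expr0 (u)) br_u add0n subr0.
(* The cofactor of u^delta is nonzero at u = 0, so at most delta factors u can be split off. *)
have jd : (j <= delta)%N.
  rewrite leqNgt; apply: contraNN hs0 => dj; rewrite -(subnKC (ltnW dj)) exprD in br2.
  have := mulfI (u_neq0 delta) (etrans (mulrA _ _ _) br2) => <-.
  by rewrite at0M at0_u subn_eq0 leqNgt dj mul0r.
have br3 : br w (w%:Z * g - j%:Z) f h2 = u ^+ (delta - j) * (w%:R * h ^+ w.-1 * s).
  apply: (mulfI (u_neq0 j)); by rewrite br2 [RHS]mulrA -exprD subnKC.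
(* The new defect is delta - j; the factor h^(w-1) gained by s adds (w - 1) k to sigma. *)
apply: (IH _ _ (w.-1 * k + sigma)%N _ _ _ h20 hs0 _ _ br3).
- by rewrite ltn_subrL j0.
- rewrite !at0M at0X at0nat -[_ * at0 s]mulrA.
  rewrite -[(w.-1 * k + sigma)%N]add0n; apply: commute_mul.
    have -> : (w%:R : {poly C})^`() = 0 by rewrite -(rmorph_nat (@polyC C)) derivC.
    by rewrite mulr0n mulr0 !mul0r.
  apply: commute_mul => //; apply: commute_exp.
  by rewrite E0 gk -pmulrn.
- have : (w.-1 * k)%N%:Z = w%:Z * k%:Z - k%:Z by case: (w) w0 => // ? _; lia.
  by lia.
Qed.

Lemma single_root_power m P z : size P = m.+1 -> (forall x, root P x -> x = z) ->
  P = lead_coef P *: ('X - z%:P) ^+ m.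
Proof.
move=> sP Pz; have P0 : P != 0 by rewrite -size_poly_gt0 sP.
have [b [Q]] := multiplicity_XsubC P z; rewrite P0 /= => Qz PE.
have Q0 : Q != 0 by apply: contraNneq Qz => ->; rewrite root0.
have sQ : (size Q + b = m.+1)%N.
  by rewrite -sP PE size_Mmonic ?monic_exp ?monicXsubC // size_exp_XsubC addnS.
have sQ1 : size Q = 1%N.
  apply/eqP/negPn/negP => sQ1; have [y Qy] : exists y, root Q y by exact/closed_rootP.
  have yz : y = z by apply: Pz; rewrite PE rootM Qy.
  by rewrite -yz Qy in Qz.
have /size_poly1P[c c0 QE] : size Q == 1%N by rewrite sQ1.
have -> : m = b by rewrite sQ1 add1n in sQ; case: sQ.
rewrite PE QE lead_coefM lead_coefC lead_coef_exp lead_coefXsubC expr1n mulr1.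
by rewrite mul_polyC.
Qed.

Lemma coefM_top (A : comNzRingType) (i j : nat) (P Q : {poly A}) : (size P <= i.+1)%N -> (size Q <= j.+1)%N ->
  (P * Q)`_(i + j) = P`_i * Q`_j.
Proof.
move=> sP sQ; rewrite coefM (bigD1 (inord i : 'I_(i + j).+1)) //=.
rewrite inordK ?ltnS ?leq_addr // addKn big1 ?addr0 // => k /eqP ki.
have [ik|ik|ikE] := ltngtP i k.
- by rewrite nth_default ?mul0r // (leq_trans sP).
- rewrite [X in _ * X]nth_default ?mulr0 // (leq_trans sQ) //; lia.
- by case: ki; apply: val_inj; rewrite /= inordK ?ltnS ?leq_addr.
Qed.

Lemma coefX_deriv (A : comNzRingType) (P : {poly A}) k : ('X * P^`())`_k = k%:R * P`_k.
Proof. by rewrite coefXM; case: k => [|k] /=; rewrite ?mul0r // coef_deriv mulr_natl. Qed.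

Lemma size_mulX_deriv (A : comNzRingType) (P : {poly A}) k :
  (size P <= k)%N -> (size ('X * P^`())%R <= k)%N.
Proof.
move=> /leq_sizeP sP; apply/leq_sizeP => j kj.
by rewrite coefX_deriv sP ?mulr0.
Qed.

Lemma mulX_derivXn a P : 'X * ('X^a * P)^`() = 'X^a * (a%:R * P + 'X * P^`()).
Proof. by rewrite derivM mulrDr mulrA mulX_deriv; ring. Qed.

Lemma comp_mulXn_deriv a P P1 z : P \Po ('X + z%:P) = 'X^a * P1 ->
  'X * (P^`() \Po ('X + z%:P)) = 'X^a * (a%:R * P1 + 'X * P1^`()).
Proof. by move=> PE; rewrite -deriv_shift PE mulX_derivXn. Qed.

(** The equation for eta = E / S in lowest terms, times S^2. At a point where S has order b > 0 and
    P order a, the lowest coefficient on the left is -(w b + k a) times a nonzero number, at an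
    order below that of the right side. So S has no root. *)
Lemma noncommuting_denominator (w k : nat) P S E : (0 < w)%N -> P != 0 -> S != 0 ->
  coprimep S E ->
  w%:R * (S * E^`() - E * S^`()) * P - k%:R * P^`() * E * S = P * S ^+ 2 ->
  size S = 1%N.
Proof.
move=> w0 P0 S0 cSE eqE; apply/eqP/negPn/negP => sS.
have [z Sz] : exists z, root S z by exact/closed_rootP.
have [a [P1 [PE P10 _]]] := shift_split z P0.
have [b [S1 [SE S10 Sr]]] := shift_split z S0.
rewrite Sz in Sr.
have Ez : (E \Po ('X + z%:P)).[0] != 0.
  rewrite horner_comp !hornerE; apply: contraTneq cSE => Ez.
  apply/negP => /coprimep_root /(_ Sz); by rewrite Ez eqxx.
have := congr1 (fun p => 'X * (p \Po ('X + z%:P))) eqE.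
rewrite /= !(rmorphB, rmorphM, rmorphXn, rmorph_nat) /=.
have HP := comp_mulXn_deriv PE; have HS := comp_mulXn_deriv SE.
set E' := E^`() \Po _; set P' := P^`() \Po _ in HP *; set S' := S^`() \Po _ in HS *.
rewrite PE SE; set E1 := E \Po _ in Ez *.
have -> : 'X * (w%:R * ('X^b * S1 * E' - E1 * S') * ('X^a * P1)
     - k%:R * P' * E1 * ('X^b * S1)) =
  w%:R * ('X^b * S1 * ('X * E') - E1 * ('X * S')) * ('X^a * P1)
     - k%:R * ('X * P') * E1 * ('X^b * S1) by ring.
rewrite HP HS => H.
have : 'X^(a + b) * (w%:R * (S1 * ('X * E') - E1 * (b%:R * S1 + 'X * S1^`())) * P1
   - k%:R * (a%:R * P1 + 'X * P1^`()) * E1 * S1 - 'X^(b.+1) * P1 * S1 ^+ 2) = 0.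
  move/eqP: H; rewrite -subr_eq0 => /eqP <-.
  by rewrite exprD exprS; ring.
move/eqP; rewrite mulf_eq0 expf_eq0 polyX_eq0 andbF /= => /eqP /(congr1 (fun p => p.[0])).
rewrite -!(rmorph_nat (@polyC C)) !(hornerM, hornerD, hornerN, hornerX, hornerC, hornerXn).
rewrite expr0n /= !(mul0r, mulr0, add0r, addr0, subr0, sub0r) => /eqP.
have -> : w%:R * - (E1.[0] * (b%:R * S1.[0])) * P1.[0] - k%:R * (a%:R * P1.[0]) * E1.[0] * S1.[0]
  = - ((w * b + k * a)%N%:R * (E1.[0] * S1.[0] * P1.[0])) by rewrite natrD !natrM; ring.
rewrite oppr_eq0 !mulf_eq0 (negbTE Ez) (negbTE S10) (negbTE P10) !orbF pnatr_eq0.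
by rewrite addn_eq0 muln_eq0 (gtn_eqF w0) (gtn_eqF (esym Sr)).
Qed.

(** At a root of P the term k P' E has the smallest order unless E vanishes there, so every root of
    P is a root of E. The top coefficient on the left carries the factor w deg E - k m, nonzero
    since k m < w; this forces deg E = 1. *)
Lemma noncommuting_numerator (w k m : nat) P E : (0 < k)%N -> (0 < m)%N ->
  (k * m < w)%N -> size P = m.+1 ->
  w%:R * E^`() * P - k%:R * P^`() * E = P ->
  exists z, forall x, root P x -> x = z.
Proof.
move=> k0 m0 kmw sP eqE; have P0 : P != 0 by rewrite -size_poly_gt0 sP.
have E0 : E != 0.
  apply: contraNneq P0 => E0; rewrite -eqE E0 deriv0; apply/eqP; ring.
have rootE x : root P x -> root E x.
  move=> Px; have [a [P1 [PE P10 Pr]]] := shift_split x P0; rewrite Px in Pr.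
  apply/negPn/negP => Ex.
  have := congr1 (fun p => 'X * (p \Po ('X + x%:P))) eqE.
  rewrite /= !(rmorphB, rmorphM, rmorph_nat) /=; have HP := comp_mulXn_deriv PE.
  set E' := E^`() \Po _; set P' := P^`() \Po _ in HP *; set E1 := E \Po _.
  have -> : 'X * (w%:R * E' * (P \Po ('X + x%:P)) - k%:R * P' * E1) =
    w%:R * ('X * E') * (P \Po ('X + x%:P)) - k%:R * ('X * P') * E1 by ring.
  rewrite HP PE => H.
  have : 'X^a * (w%:R * ('X * E') * P1 - k%:R * (a%:R * P1 + 'X * P1^`()) * E1
     - 'X * P1) = 0.
    by move/eqP: H; rewrite -subr_eq0 => /eqP <-; ring.
  move/eqP; rewrite mulf_eq0 expf_eq0 polyX_eq0 andbF /= => /eqP /(congr1 (fun p => p.[0])).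
  rewrite -!(rmorph_nat (@polyC C)) !(hornerM, hornerD, hornerN, hornerX, hornerC).
  rewrite !(mul0r, mulr0, add0r, addr0, subr0) => /eqP.
  rewrite oppr_eq0 !mulf_eq0 (negbTE P10) !pnatr_eq0 (gtn_eqF k0) (gtn_eqF (esym Pr)) /=.
  by rewrite /E1 horner_comp !hornerE -/(root E x) (negbTE Ex).
have [x0 Px0] : exists x, root P x.
  by apply/closed_rootP; rewrite sP eqSS -lt0n.
have [n sE] : exists n, size E = n.+2.
  have := root_size_gt1 E0 (rootE _ Px0).
  by case: (size E) => [|[|n]] // _; exists n.
have sE2 : n = 0%N.
  have H : w%:R * ('X * E^`() * P) - k%:R * ('X * P^`() * E) = P * 'X.
    by rewrite -{3}eqE; ring.
  have /(congr1 (fun p : {poly C} => p`_(n.+1 + m))) := H.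
  rewrite -!(rmorph_nat (@polyC C)) coefB !coefCM coefMX.
  rewrite (@coefM_top _ n.+1 m ('X * E^`())) ?size_mulX_deriv ?sE ?sP //.
  rewrite [(n.+1 + m)%N]addnC (@coefM_top _ m n.+1 ('X * P^`())) ?size_mulX_deriv ?sE ?sP //.
  rewrite !coefX_deriv addnS /= => H2.
  have : (w%:R * n.+1%:R - k%:R * m%:R) * (lead_coef E * lead_coef P) = P`_(m + n).
    by rewrite -H2 !lead_coefE sE sP /=; ring.
  case: (n) => // n'; rewrite nth_default ?sP ?addnS ?ltnS ?leq_addr // => /eqP.
  rewrite !mulf_eq0 !lead_coef_eq0 (negbTE P0) (negbTE E0) !orbF subr_eq0.
  rewrite -!natrM eqr_nat => /eqP; nia.
exists x0 => x /rootE Ex.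
have /dvdpP[R1 ER1] : 'X - x0%:P %| E by rewrite dvdp_XsubCl rootE.
have sR1 : size R1 = 1%N.
  have R10 : R1 != 0 by apply: contraNneq E0 => R10; rewrite ER1 R10 mul0r.
  by move: sE; rewrite sE2 ER1 size_Mmonic ?monicXsubC // size_XsubC addn2 => -[].
move/eqP/size_poly1P: sR1 => [c c0 RE].
by move: Ex; rewrite ER1 RE rootM rootC (negbTE c0) root_XsubC => /eqP.
Qed.

(* With eta = P U / S the equation reads [w eta' P - k P' eta = P]; comparing
   orders at the roots of P and degrees, eta is a polynomial of degree 1
   vanishing at every root of P. *)
Lemma noncommuting_single_root (w k m tau : nat) P U S : (0 < w)%N -> (0 < k)%N ->
  (0 < m)%N -> (k * m < w)%N -> size P = m.+1 -> S != 0 ->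
  w%:R * P * S^`() = tau%:R * P^`() * S ->
  w%:R * P * U^`() - ((k + tau)%:Z - w%:Z)%:~R * P^`() * U = S ->
  exists z, P = lead_coef P *: ('X - z%:P) ^+ m.
Proof.
move=> w0 k0 m0 kmw sP S0 eqS eqU; have P0 : P != 0 by rewrite -size_poly_gt0 sP.
(* eta = E / S, and E1 / S1 is the same fraction in lowest terms; multiplied by the square of the
   denominator, the equation holds for both. *)
pose E := P * U; pose D := gcdp S E.
have D0 : D != 0 by rewrite gcdp_eq0 negb_and S0.
pose S1 := S %/ D; pose E1 := E %/ D.
have SE : S = S1 * D by rewrite divpK // dvdp_gcdl.
have EE : E = E1 * D by rewrite divpK // dvdp_gcdr.
have S10 : S1 != 0 by apply: contraNneq S0 => S10; rewrite SE S10 mul0r.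
have cop : coprimep S1 E1 by rewrite coprimep_div_gcd // S0.
have eqE : w%:R * (S * E^`() - E * S^`()) * P - k%:R * P^`() * E * S = P * S ^+ 2.
  have -> : P * S ^+ 2 = P * S *
      (w%:R * P * U^`() - ((k + tau)%:Z - w%:Z)%:~R * P^`() * U).
    by rewrite eqU; ring.
  have -> : w%:R * (S * E^`() - E * S^`()) * P = w%:R * S * E^`() * P - E * (w%:R * P * S^`()).
    by ring.
  rewrite eqS /E derivM intrD intrN -!pmulrn natrD; ring.
have eqE1 : w%:R * (S1 * E1^`() - E1 * S1^`()) * P - k%:R * P^`() * E1 * S1 = P * S1 ^+ 2.
  apply: (mulIf (expf_neq0 2 D0)).
  have -> : P * S1 ^+ 2 * D ^+ 2 = P * S ^+ 2 by rewrite SE; ring.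
  by rewrite -eqE SE EE !derivM; ring.
have sS1 := noncommuting_denominator w0 P0 S10 cop eqE1.
move/eqP/size_poly1P: sS1 => [c c0 S1E].
have [z zP] : exists z, forall x, root P x -> x = z.
  apply: (@noncommuting_numerator w k m P (c^-1%:P * E1)) => //.
  have cP0 : c%:P ^+ 2 != 0 :> {poly C} by rewrite expf_neq0 // polyC_eq0.
  have cc : c^-1%:P * c%:P = 1 :> {poly C} by rewrite -polyCM mulVf.
  apply: (mulIf cP0); rewrite -S1E -eqE1 S1E !derivM !derivC mul0r mulr0 add0r subr0.
  transitivity ((c^-1%:P * c%:P) * (w%:R * (c%:P * E1^`()) * P - k%:R * P^`() * E1 * c%:P)).
    by ring.
  by rewrite cc mul1r.
by exists z; exact: single_root_power.
Qed.

(** * The leading edge *)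

(* u^i z^m, with coefficient 1, has the largest weight in f when x has weight N
   and y has weight -l, and m is the degree in z. *)
Definition corner (N l m i : nat) f :=
  [/\ forall i' j, (f`_j)`_i' != 0 -> (N * i + l * m <= N * i' + l * j)%N,
      (f`_m)`_i = 1 & forall j, (m < j)%N -> f`_j = 0].

Lemma corner_rescale N l m i f : (0 < N)%N -> corner N l m i f ->
  exists h, [/\ rescale N l f = u ^+ (N * i + l * m) * h,
    f`_0 \Po 'X^N = 'X^(N * i + l * m) * h`_0,
    size (at0 h) = m.+1, at0 h \is monic &
    (forall i' j, (N * i' + l * j = N * i + l * m)%N -> (at0 h)`_j = (f`_j)`_i') /\
    forall j, (at0 h)`_j != 0 -> exists i', (N * i' + l * j = N * i + l * m)%N].
Proof.
move=> N0 [fge fm fgt]; have [h [hE hc h0 h1]] := rescale_div N0 fge.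
have Pm : (at0 h)`_m = 1 by rewrite (h0 i m).
have sP : size (at0 h) = m.+1.
  apply/anti_leq/andP; split.
    apply/leq_sizeP => j mj; rewrite coef_at0.
    suff -> : h`_j = 0 by rewrite coef0.
    have /eqP := hc j; rewrite fgt // comp_poly0 mul0r eq_sym mulf_eq0.
    by rewrite expf_eq0 polyX_eq0 andbF => /eqP.
  rewrite ltnNge; apply/negP => /(nth_default 0) /eqP.
  by rewrite Pm oner_eq0.
exists h; split => //; first by rewrite -hc muln0 mulr1.
by rewrite monicE lead_coefE sP Pm.
Qed.

Lemma corner_low m i N l f i' : (0 < N)%N -> corner N l m i f ->
  (i' < i)%N -> (f`_m)`_i' = 0.
Proof.
move=> N0 [fge _ _] ii; apply/eqP/negPn/negP => /fge; rewrite leq_add2r.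
by rewrite leq_pmul2l // leqNgt ii.
Qed.

Lemma coef_theta_top P i (d : nat) : (forall i', (i' < i)%N -> P`_i' = 0) -> P`_i = 1 ->
  exists Q, [/\ P = 'X^i * Q, Q`_0 = 1 &
    d%:R * P - 'X * P^`() = 'X^i * ((d%:Z - i%:Z)%:~R * Q - 'X * Q^`())].
Proof.
move=> Plow Pi; exists (drop_poly i P).
have PE := low_coefs_div Plow.
split => //; first by rewrite coef_drop_poly.
by rewrite {1 2}PE mulX_derivXn intrB -!pmulrn; ring.
Qed.

(** The bracket is free of z, so its coefficient at z^(m+n-1) vanishes; the lowest term in u of that
    coefficient makes (d - i, m) and (e - j, n) proportional. *)
Lemma corner_proportional N l m n i j (d e : nat) f g (K : C) s : (0 < N)%N ->
  (1 < m)%N -> corner N l m i f -> corner N l n j g ->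
  br d e f g = (K *: 'X^s)%:P -> K != 0 ->
  (0 < n)%N /\ n%:Z * (d%:Z - i%:Z) = m%:Z * (e%:Z - j%:Z).
Proof.
move=> N0 m1 cf cg brE K0; have [_ fm fgt] := cf; have [_ gn ggt] := cg.
have sf : (size f <= m.+1)%N by apply/leq_sizeP => k mk; exact: fgt.
have sg : (size g <= n.+1)%N by apply/leq_sizeP => k mk; exact: ggt.
have [Q [fQ Q0 thQ]] := coef_theta_top d (fun k => corner_low N0 cf) fm.
have [S [gS S0 thS]] := coef_theta_top e (fun k => corner_low N0 cg) gn.
have sD (p : {poly {poly C}}) k (q : nat) : (size p <= k)%N ->
    (size (q%:Z%:~R * p - theta p)%R <= k)%N.
  move=> /leq_sizeP sp; apply/leq_sizeP => y ky.
  by rewrite coefB coef_theta -(rmorph_int (@polyC {poly C})) coefCM sp ?deriv0 ?mulr0 ?subr0.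
have topE : n%:R * (d%:R * f`_m - 'X * (f`_m)^`()) * g`_n
    = m%:R * f`_m * (e%:R * g`_n - 'X * (g`_n)^`()).
  have : ('X * br d e f g)`_(m + n) = 0.
    rewrite brE coefXM coefC; case: (m + n)%N (ltn_addr n m1) => // -[|k] //=.
  have -> : 'X * br d e f g = (d%:Z%:~R * f - theta f) * ('X * g^`()) -
      ('X * f^`()) * (e%:Z%:~R * g - theta g) by rewrite /br; ring.
  rewrite coefB !coefM_top ?sD ?size_mulX_deriv // !coefX_deriv !coefB !coef_theta.
  rewrite -!(rmorph_int (@polyC {poly C})) !coefCM -!pmulrn => /eqP.
  by rewrite subr_eq0 => /eqP E; rewrite -E; ring.
have prop : n%:Z * (d%:Z - i%:Z) = m%:Z * (e%:Z - j%:Z).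
  have : 'X^(i + j) * (n%:R * ((d%:Z - i%:Z)%:~R * Q - 'X * Q^`()) * S
      - m%:R * Q * ((e%:Z - j%:Z)%:~R * S - 'X * S^`())) = 0.
    move/eqP: topE; rewrite thQ thS fQ gS -subr_eq0 => /eqP <-.
    by rewrite exprD; ring.
  move/eqP; rewrite mulf_eq0 expf_eq0 polyX_eq0 andbF /= => /eqP.
  move=> /(congr1 (fun p => p.[0])); rewrite -!(rmorph_nat (@polyC C)).
  rewrite -!(rmorph_int (@polyC C)) !(hornerM, hornerD, hornerN, hornerX, hornerC).
  rewrite !mul0r !subr0 !horner_coef0 Q0 S0 !mulr1 => /eqP; rewrite subr_eq0.
  by rewrite !pmulrn -!intrM eqr_int => /eqP.
(* For n = 0 the element g is free of z, and the top coefficient gives e g = [theta g]; then both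
   products in the bracket vanish. *)
split=> //; rewrite lt0n; apply/negP => /eqP n0; subst n.
have gC : g = (g`_0)%:P.
  by apply/polyP => -[|k]; rewrite coefC //= ggt.
have th0 : e%:Z%:~R * g - theta g = 0.
  have f0 : f`_m != 0 by apply: contra_eq_neq fm => ->; rewrite coef0 eq_sym oner_neq0.
  move/eqP: topE; rewrite !mul0r eq_sym !mulf_eq0 (negbTE f0) orbF.
  rewrite -(rmorph_nat (@polyC C)) polyC_eq0 pnatr_eq0 -leqn0 leqNgt (ltnW m1) /=.
  move=> /eqP E; rewrite gC thetaC -(rmorph_int (@polyC {poly C})) -polyCM -polyCB.
  by rewrite -pmulrn E polyC0.
move/eqP: brE; rewrite /br th0 gC derivC !mulr0 subr0 eq_sym polyC_eq0 -mul_polyC.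
by rewrite mulf_eq0 polyC_eq0 (negbTE K0) expf_eq0 polyX_eq0 andbF.
Qed.

(** Splitting off x^(d+e-1) turns the constant bracket c into c u^(d+e-1); this is that identity in
    the coordinates of the edge. *)
Lemma edge_bracket N l (d e kf kg : nat) f g h k (c : C) :
  br d e f g = (c *: 'X^((d + e).-1))%:P ->
  rescale N l f = u ^+ kf * h -> rescale N l g = u ^+ kg * k ->
  u ^+ (kf + kg) * br ((N * d)%N%:Z - kf%:Z) ((N * e)%N%:Z - kg%:Z) h k =
  u ^+ (l + N * (d + e).-1) * (N%:R * c)%:P%:P.
Proof.
move=> brE fE gE; rewrite -br_u -fE -gE !PoszM br_rescale brE rescaleC.
rewrite comp_polyZ rmorphXn /= comp_polyX -exprM /u -!rmorphXn /= -!mul_polyC.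
by rewrite !rmorphM /= !rmorph_nat !rmorphXn /= [in RHS]exprD; ring.
Qed.

Lemma u_exp_le a b p (c : C) : c != 0 -> u ^+ a * p = u ^+ b * c%:P%:P ->
  (a <= b)%N /\ p = u ^+ (b - a) * c%:P%:P.
Proof.
move=> c0 E; have ab : (a <= b)%N.
  rewrite leqNgt; apply/negP => ba; move: E; rewrite -(subnKC (ltnW ba)) exprD -mulrA.
  move/(mulfI (u_neq0 b))/(congr1 (at0)).
  rewrite at0M at0_u subn_eq0 leqNgt ba mul0r at0C coefC /= => /esym/eqP.
  by rewrite polyC_eq0 (negbTE c0).
by split=> //; apply: (mulfI (u_neq0 a)); rewrite E mulrA -exprD subnKC.
Qed.

(** This excludes -1 < p < 0, where p = -l/N; the condition i + m < d expresses m0 > m. *)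
Lemma no_shallow_edge N l m n i j (d e : nat) f g (c : C) i' j' :
  (0 < l)%N -> (l < N)%N -> (1 < m)%N -> (i + m < d)%N ->
  corner N l m i f -> corner N l n j g ->
  br d e f g = (c *: 'X^((d + e).-1))%:P -> c != 0 ->
  (j' < m)%N -> (f`_j')`_i' != 0 -> (N * i' + l * j' = N * i + l * m)%N -> False.
Proof.
move=> l0 lN m1 dim cf cg brE c0 jm fj ij.
have N0 : (0 < N)%N by exact: leq_trans lN.
have [n0 prop] := corner_proportional N0 m1 cf cg brE c0.
have [h [hE _ sP Pm [hc hx]]] := corner_rescale N0 cf.
have [k [kE _ sQ Qm _]] := corner_rescale N0 cg.
have Nc : N%:R * c != 0 by rewrite mulf_neq0 // pnatr_eq0 -lt0n.
have [kd brhk] := u_exp_le Nc (edge_bracket brE hE kE).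
pose w := (N * d - (N * i + l * m))%N.
have wE : (N * d)%N%:Z - (N * i + l * m)%N%:Z = w%:Z.
  by rewrite /w; nia.
(* From d - i > m; this is the degree bound needed in [noncommuting_single_root] with k = N - l. *)
have wm : ((N - l) * m < w)%N by rewrite /w; nia.
rewrite wE in brhk; set E := (N * e)%N%:Z - _ in brhk.
have EE : m%:Z * E = n%:Z * w%:Z by rewrite /E -wE; nia.
have P0 : at0 h != 0 by rewrite monic_neq0.
have Q0 : at0 k != 0 by rewrite monic_neq0.
have s0 : at0 (N%:R * c)%:P%:P != 0 :> {poly C} by rewrite at0C coefC polyC_eq0.
have w0 : (0 < w)%N by exact: leq_ltn_trans wm.
have sP1 : (1 < size (at0 h))%N by rewrite sP ltnS ltnW.
have sW : w%:R * at0 h * (at0 (N%:R * c)%:P%:P)^`() =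
    0%:R * (at0 h)^`() * at0 (N%:R * c)%:P%:P.
  by rewrite at0C derivC mulr0 !mul0r.
(* Here kappa = N - l; sigma = 0 because the bracket is a constant times a power of u, and delta is
   the exponent of that power. *)
have gE : w%:Z + E = (l + N * (d + e).-1 - (N * i + l * m + (N * j + l * n)) + (N - l) + 0)%N.
  by rewrite /E -wE; lia.
have [tau [U [S [S0 SW UW]]]] := noncommuting w0 sP1 Q0 s0 sW gE brhk.
have Nl0 : (0 < N - l)%N by rewrite subn_gt0.
have [z Pz] := noncommuting_single_root w0 Nl0 (ltnW m1) wm sP S0 SW UW.
rewrite (monicP Pm) scale1r in Pz.
have z0 : z != 0.
  apply: contra_neq fj => z0; rewrite -(hc _ _ ij) Pz z0 subr0 coefXn.
  by rewrite (ltn_eqF jm).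
(* The coefficient at X^(m-1) of (X - z)^m is nonzero; the corresponding point of the edge forces N
   to divide l, although 0 < l < N. *)
have : (at0 h)`_m.-1 != 0.
  rewrite Pz -{1}(prednK (ltnW m1)) coef_exp_XsubC oppr_eq0 mulf_neq0 //.
  by rewrite pnatr_eq0.
move=> /hx[i2 i2E]; have E2 : (N * i2 = N * i + l)%N.
  apply/eqP; rewrite -(eqn_add2r (l * m.-1)) i2E -addnA -mulnS.
  by rewrite (prednK (ltnW m1)).
have /(dvdn_leq l0) : (N %| l)%N.
  by rewrite -(dvdn_addr l (dvdn_mulr i (dvdnn N))) -E2 dvdn_mulr.
by rewrite leqNgt lN.
Qed.

(* Each root [t] of the leading form is shifted to 0; by [descent] the residue
   of [G dF] vanishes there, and that residue is an affine function of [t]. *)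
Lemma slope_one_edge m n i j (d e : nat) f g (c : C) i' j' :
  (1 < m)%N -> (0 < d + e)%N -> (i + m != d)%N ->
  corner 1 1 m i f -> corner 1 1 n j g ->
  br d e f g = (c *: 'X^((d + e).-1))%:P -> c != 0 ->
  (j' < m)%N -> (f`_j')`_i' != 0 -> (i' + j' = i + m)%N ->
  ares d (d + e) f`_0 g`_0 != 0 /\
  exists2 z, z != 0 & forall i' j', (i' + j' = i + m)%N ->
    (f`_j')`_i' = (('X - z%:P) ^+ m)`_j'.
Proof.
move=> m1 de dim cf cg brE c0 jm fj ij.
have [n0 prop] := corner_proportional (ltn0Sn 0) m1 cf cg brE c0.
have [h [hE h00 sP Pm [hc hx]]] := corner_rescale (ltn0Sn 0) cf.
have [k [kE k00 sQ Qm _]] := corner_rescale (ltn0Sn 0) cg.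
have c1 : 1%:R * c != 0 by rewrite mul1r.
have [kd brhk] := u_exp_le c1 (edge_bracket brE hE kE).
rewrite !mul1n in kd brhk h00 k00 hc hx.
have Em : m%:Z * (e%:Z - (j + n)%N%:Z) = n%:Z * (d%:Z - (i + m)%N%:Z) by nia.
(* The weights d - (i + m) and e - (j + n) have the same sign by proportionality, and [kd] makes
   their sum nonnegative. *)
have D0 : (i + m < d)%N.
  rewrite ltn_neqAle dim leqNgt; apply/negP => dlt.
  have : e%:Z - (j + n)%N%:Z < 0 by nia.
  by lia.
have E0 : (j + n < e)%N by nia.
pose D := (d - (i + m))%N; pose E := (e - (j + n))%N.
have DE : d%:Z - (i + m)%N%:Z = D%:Z by rewrite /D; lia.
have EE : e%:Z - (j + n)%N%:Z = E%:Z by rewrite /E; lia.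
have {}brhk : br D E h k = (c *: 'X^(D + E))%:P.
  rewrite -DE -EE brhk mul1r /u -rmorphXn /= -rmorphM /= -mul_polyC mulrC.
  by congr ((_ * 'X^_)%:P); rewrite /D /E; lia.
have P0 : at0 h != 0 by rewrite monic_neq0.
have Q0 : at0 k != 0 by rewrite monic_neq0.
have aresE : ares D (D + E) h`_0 k`_0 = ares d (d + e) f`_0 g`_0.
  have := @ares_rescale 1 d (d + e) f`_0 g`_0 isT.
  rewrite h00 k00 !mul1r !mul1n => <-.
  have -> : (d + e = i + m + (j + n) + (D + E))%N by rewrite /D /E; lia.
  by rewrite ares_Xn DE.
(* The exponent of u in the bracket is exactly D + E, so the residue moves with t at the rate c, and
   [descent] applies with L = 0. *)
have root0 t : root (at0 h) t -> ares d (d + e) f`_0 g`_0 + c * t = 0.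
  move=> ht; have [a [P1 [PE P10 Pr]]] := shift_split t P0; rewrite ht in Pr.
  pose s := 'X + t%:P%:P : {poly {poly C}}.
  have brS : br D E (h \Po s) (k \Po s) = (c *: 'X^(D + E + 0))%:P.
    by rewrite br_comp brhk comp_polyC addn0.
  have kS : at0 (k \Po s) != 0 by rewrite at0_shift comp_poly2_eq0 ?size_XaddC.
  have hS : at0 (h \Po s) = 'X^a * P1 by rewrite at0_shift.
  have D1 : (0 < D)%N by rewrite subn_gt0.
  have E1 : (0 < E)%N by rewrite subn_gt0.
  have := descent D1 E1 brS hS P10 (esym Pr) kS.
  rewrite !comp_shift0 (ares_horner t _ brhk) // !horner_coef0 aresE eqxx mul1r.
  by [].
pose A := ares d (d + e) f`_0 g`_0.
have rootA x : root (at0 h) x -> x = - A / c.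
  move=> /root0/eqP; rewrite -/A addr_eq0 => /eqP ->.
  by rewrite opprK mulrAC divff // mul1r.
have := single_root_power sP rootA; rewrite (monicP Pm) scale1r => PE.
(* The second point on the edge, with j' < m, keeps the leading form from being X^m. *)
have z0 : - A / c != 0.
  apply: contra_neq fj => z0; rewrite -(hc i') ?mul1n // PE z0 subr0 coefXn.
  by rewrite (ltn_eqF jm).
split; last first.
  by exists (- A / c) => // i2 j2 ij2; rewrite -PE (hc i2) // !mul1n.
by apply: contra_neq z0; rewrite -/A => ->; rewrite oppr0 mul0r.
Qed.

(** The two residues add up to that of d(FG), which is 0. *)
Lemma ares_swap (d e n : nat) P Q : n = (d + e)%N -> ares e n Q P = - ares d n P Q.
Proof.
move=> ->; apply/eqP; rewrite -addr_eq0 /ares -coefD.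
have -> : P * (e%:~R * Q - 'X * Q^`()) + Q * (d%:~R * P - 'X * P^`()) =
  (d + e)%:R * (P * Q) - 'X * (P * Q)^`() by rewrite derivM natrD -!pmulrn; ring.
by rewrite coefB -(rmorph_nat (@polyC C)) coefCM coefX_deriv subrr.
Qed.

(** Without negative powers of x, only the product of the coefficients of x^0 reaches u^(d+e), and
    the factor d - d kills it. *)
Lemma ares_poly (d e : nat) P Q : (size P <= d.+1)%N -> (size Q <= e.+1)%N ->
  ares d (d + e) P Q = 0.
Proof.
move=> sP sQ; rewrite /ares addnC coefM_top //; last first.
  apply/leq_sizeP => k dk; rewrite coefB -(rmorph_int (@polyC C)) coefCM coefX_deriv.
  by move/leq_sizeP: sP => ->; rewrite ?mulr0 ?subr0.
rewrite coefB -(rmorph_int (@polyC C)) coefCM coefX_deriv.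
by rewrite -pmulrn subrr mulr0.
Qed.

(** * The shift of y by b/x *)

Lemma coef_shift_exp m (b : C) j : (('X + ('X * b%:P)%:P) ^+ m : {poly {poly C}})`_j =
  'X^(m - j) * ((('X + b%:P) ^+ m)`_j)%:P.
Proof.
elim: m j => [|m IH] j.
  by rewrite !expr0 mul1r !coef1 rmorph_nat.
have big k : (m < k)%N -> (('X + b%:P) ^+ m)`_k = 0.
  move=> mk; apply: nth_default; apply: leq_trans mk.
  by rewrite (leq_trans (size_poly_exp_leq _ _)) // size_XaddC mul1n.
rewrite !exprS !mulrDl !coefD !coefXM !coefCM !IH rmorphD rmorphM /=.
case: j => [|j] /=; first by rewrite !subn0 polyC0 !add0r exprS; ring.
rewrite subSS; have [jm|mj] := ltnP j m; last first.
  by rewrite (big j.+1) ?ltnS // polyC0; ring.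
by rewrite -(subnSK jm) exprS; ring.
Qed.

(** In the coordinate z = x y this shift is the translation of z by b. *)
Lemma rescale_shift (b : C) f :
  rescale 1 1 (f \Po ('X + ('X * b%:P)%:P)) = rescale 1 1 f \Po ('X + b%:P%:P).
Proof.
have rX : rescale 1 1 'X = u * 'X.
  apply/polyP => -[|[|i]]; rewrite coef_rescale -[u]expr1 coef_uM !coefX /= ?expr1;
    by rewrite ?rmorph0 ?rmorph1 ?mul0r ?mulr0 ?mul1r ?mulr1.
have sE : rescale 1 1 ('X + ('X * b%:P)%:P) = u * ('X + b%:P%:P).
  rewrite rescaleD rX rescaleC comp_polyM comp_polyX comp_polyC polyCM expr1 /u.
  by ring.
elim/poly_ind: f => [|f P IH].
  have r0 : rescale 1 1 (0 : {poly {poly C}}) = 0.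
    by apply/polyP => i; rewrite coef_rescale !coef0 comp_poly0 mul0r.
  by rewrite !(comp_poly0, r0).
rewrite comp_polyD comp_polyM comp_polyX comp_polyC !rescaleD !rescaleM IH sE rX.
by rewrite rescaleC !(comp_polyD, comp_polyM, comp_polyX, comp_polyC) expr1.
Qed.

(** The translation turns the edge polynomial (X - z)^m into X^m, so only the corner remains on the
    edge. *)
Lemma shift_edge m i f (z : C) : corner 1 1 m i f ->
  (forall i' j', (i' + j' = i + m)%N -> (f`_j')`_i' = (('X - z%:P) ^+ m)`_j') ->
  forall i' j', (j' < m)%N -> ((f \Po ('X + ('X * z%:P)%:P))`_j')`_i' != 0 ->
  (i + m < i' + j')%N.
Proof.
move=> cf fE i' j' jm fj; have [h [hE _ sP Pm [hc _]]] := corner_rescale (ltn0Sn 0) cf.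
have PE : at0 h = ('X - z%:P) ^+ m.
  apply/polyP => j; have [jim|jim] := leqP j (i + m).
    by rewrite (hc (i + m - j)%N) ?fE ?mul1n ?subnK.
  rewrite !nth_default ?size_exp_XsubC ?sP //; lia.
have := rescale_shift z f; rewrite hE comp_polyM.
have -> : u ^+ (1 * i + 1 * m) \Po ('X + z%:P%:P) = u ^+ (i + m).
  by rewrite !mul1n /u -rmorphXn /= comp_polyC.
move=> /(congr1 (fun p : {poly {poly C}} => p`_j'`_(i' + j'))).
rewrite coef_rescale comp_polyXr mul1n coefMXn ltnNge leq_addl /= addnK coef_uM coefXnM.
case: ltngtP => // [_ E|ij E]; first by rewrite E eqxx in fj.
move: fj; rewrite E ij subnn -coef_at0 at0_shift PE rmorphXn /= comp_polyB.
by rewrite comp_polyX comp_polyC addrK coefXn (ltn_eqF jm) eqxx.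
Qed.

(** The coefficient of y^0 in the bracket sees only the rows 0 and 1 of f. For m >= 2 this gives f a
    nonzero row below the top, hence a finite prime degree. *)
Lemma br_const_low (d e : int) f g P : br d e f g = P%:P -> P != 0 ->
  exists2 j, (j < 2)%N & f`_j != 0.
Proof.
move=> brE P0; have [f0|f0] := eqVneq f`_0 0; last by exists 0%N.
exists 1%N => //; apply: contraNneq P0 => f1.
have := congr1 (fun p : {poly {poly C}} => p`_0) brE.
rewrite /br coefC /= coefB !coef0M coefB coef_theta coef0M f0 deriv0 mulr0.
by rewrite mulr0 subrr mul0r coef_deriv f1 mul0rn mul0r subrr => <-.
Qed.

End Polynomials.

Section Representation.
Variable R : realType.
Implicit Types (f g h : {poly {poly R[i]}}) (F G : xyseries R) (a : xseries R).

(** * Series as bivariate polynomials *)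

(** h enumerates the only indices that can contribute, for instance the exponents d - i of x. *)
Lemma fsum_inj (T : choiceType) (h : nat -> T) n (F : T -> R[i]) : injective h ->
  (forall t, F t != 0 -> exists2 i, (i < n)%N & t = h i) ->
  \sum_(t \in [set: T]) F t = \sum_(i < n) F (h i).
Proof.
move=> hI HF; rewrite (fsbigE (map h (iota 0 n))); last 3 first.
- by rewrite map_inj_uniq ?iota_uniq.
- by [].
- move=> t _ tn; apply/eqP/negPn/negP => /HF[i ni tE]; case/negP: tn.
  by apply/mapP; exists i => //; rewrite mem_iota.
rewrite big_map -[X in iota _ X]subn0 -/(index_iota 0 n) big_mkord.
by apply: eq_bigl => i; rewrite in_setT.
Qed.

Lemma fsum_neq0 (T : choiceType) (F : T -> R[i]) :
  \sum_(t \in [set: T]) F t != 0 -> exists t, F t != 0.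
Proof.
move=> S0; apply/not_existsP => H; move/eqP: S0; apply; apply: fsbig1 => t _.
by apply/eqP/negPn/negP; exact: H.
Qed.

(* F = x ^ d f with y the outer and u = 1 / x the inner variable of f. *)
Definition represents (d : int) f F :=
  (forall i j : nat, F j%:Z (d%:~R - i%:R) = (f`_j)`_i) /\
  (forall j q, F j q != 0 -> exists i j' : nat, j = j'%:Z /\ q = d%:~R - i%:R).

Lemma rep_inj d f g F : represents d f F -> represents d g F -> f = g.
Proof. by move=> [Ff _] [Fg _]; apply/polyP => j; apply/polyP => i; rewrite -Ff -Fg. Qed.

Lemma rep_ext d f F G : represents d f F -> represents d f G -> F = G.
Proof.
move=> [Ff F0] [Gf G0]; apply/funext => j; apply/funext => q.
have [Fj|Fj] := eqVneq (F j q) 0; last first.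
  by have [i [j' [-> ->]]] := F0 _ _ Fj; rewrite Ff Gf.
have [->//|Gj] := eqVneq (G j q) 0.
by have [i [j' [-> ->]]] := G0 _ _ Gj; rewrite Ff Gf.
Qed.

Lemma xmul_neq0 (a b : xseries R) q : xmul a b q != 0 ->
  exists r, a r != 0 /\ b (q - r) != 0.
Proof.
by move=> /fsum_neq0[r]; rewrite mulf_eq0 negb_or => /andP[? ?]; exists r.
Qed.

Lemma rep_mul d e f g F G : represents d f F -> represents e g G ->
  represents (d + e) (f * g) (xymul F G).
Proof.
move=> [Ff F0] [Gg G0]; split=> [i j|j q /fsum_neq0[k /xmul_neq0[r []]]]; last first.
  move=> /F0[i1 [j1 [-> ->]]] /G0[i2 [j2 [jE qE]]]; exists (i1 + i2)%N, (j1 + j2)%N.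
  split; first lia.
  by rewrite intrD natrD -(subrK (d%:~R - i1%:R) q) qE; ring.
rewrite coefM coef_sum /xymul (@fsum_inj _ Posz j.+1); first last.
- move=> k /xmul_neq0[r [/F0[i1 [j1 [-> _]]] /G0[i2 [j2 [jE _]]]]].
  by exists j1 => //; lia.
- by move=> x y [].
apply: eq_bigr => -[k /= kj] _; rewrite coefM.
have -> : j%:Z - k%:Z = (j - k)%N%:Z by lia.
rewrite /xmul (@fsum_inj _ (fun i' : nat => d%:~R - i'%:R) i.+1); first last.
- move=> r; rewrite mulf_eq0 negb_or => /andP[/F0[i1 [j1 [_ rE]]] /G0[i2 [j2 [_]]]].
  rewrite rE => qE; exists i1 => //; rewrite ltnS.
  have : i%:R = i1%:R + i2%:R :> rat.
    by move/eqP: qE; rewrite intrD => /eqP qE; lra.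
  by rewrite -natrD => /eqP; rewrite eqr_nat => /eqP ->; exact: leq_addr.
- by move=> x y /(congr1 (fun z => d%:~R - z)); rewrite !subKr => /eqP; rewrite eqr_nat => /eqP.
apply: eq_bigr => -[i' /= ii'] _; rewrite Ff; congr (_ * _).
have -> : (d + e)%:~R - i%:R - (d%:~R - i'%:R) = e%:~R - (i - i')%N%:R :> rat.
  by rewrite intrD natrB //; ring.
by rewrite Gg.
Qed.

Lemma rep_sub d f g F G : represents d f F -> represents d g G ->
  represents d (f - g) (xysub F G).
Proof.
move=> [Ff F0] [Gg G0]; split=> [i j|j q]; first by rewrite /xysub Ff Gg !coefB.
rewrite /xysub => FG; have [Fj|/F0//] := eqVneq (F j q) 0.
by apply: G0; apply: contraNneq FG => ->; rewrite Fj subr0.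
Qed.

Lemma rep_ddx d f F : represents d f F ->
  represents (d - 1) (d%:~R * f - theta f) (ddx F).
Proof.
move=> [Ff F0]; split=> [i j|j q]; last first.
  rewrite /ddx mulf_eq0 negb_or => /andP[_ /F0[i [j' [-> qE]]]].
  exists i, j'; split=> //; rewrite rmorphB /=; lra.
have qE : (d - 1)%:~R - i%:R + 1 = d%:~R - i%:R :> rat by rewrite rmorphB /=; ring.
rewrite /ddx qE Ff !coefB coef_theta -(rmorph_int (@polyC {poly R[i]})) coefCM.
rewrite -(rmorph_int (@polyC R[i])) coefCM coefX_deriv.
by rewrite rmorphB /= ratr_int ratr_nat mulrBl.
Qed.

Lemma rep_ddy d f F : represents d f F -> represents d f^`() (ddy F).
Proof.
move=> [Ff F0]; split=> [i j|j q]; last first.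
  rewrite /ddy mulf_eq0 negb_or => /andP[j0 /F0[i [[|j'] [jE ->]]]].
    by move: j0; rewrite jE eqxx.
  by exists i, j'; split=> //; lia.
rewrite /ddy coef_deriv coefMn -[RHS]mulr_natl.
have -> : j%:Z + 1 = j.+1%:Z by lia.
by rewrite Ff.
Qed.

Lemma rep_bracket d e f g F G : represents d f F -> represents e g G ->
  represents (d + e - 1) (br d e f g) (bracket F G).
Proof.
move=> Ff Gg; apply: rep_sub.
  have -> : d + e - 1 = d - 1 + e by ring.
  by apply: rep_mul; [exact: rep_ddx|exact: rep_ddy].
have -> : d + e - 1 = d + (e - 1) by ring.
by apply: rep_mul; [exact: rep_ddy|exact: rep_ddx].
Qed.

Lemma rep_monom d (c : R[i]) (i j : nat) :
  represents d (('X^i * c%:P)%:P * 'X^j) (xymonom c (d%:~R - i%:R) j).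
Proof.
split=> [i' j'|j' q]; rewrite /xymonom.
  rewrite eqz_nat coefCM coefXn.
  have -> : (d%:~R - i'%:R == d%:~R - i%:R :> rat) = (i' == i).
    by rewrite (inj_eq (addrI _)) eqr_opp eqr_nat.
  case: (j' == j); rewrite /= ?mulr0 ?coef0 // mulr1 coefMC coefXn.
  by case: (i' == i); rewrite ?mul1r ?mul0r.
by case: ifP => [/andP[/eqP -> /eqP ->] _|_]; [exists i, j|rewrite eqxx].
Qed.

Lemma rep_const d (c : R[i]) : represents d%:Z ('X^d * c%:P)%:P (xyconst c).
Proof.
rewrite /xyconst; have := rep_monom d c d 0; rewrite expr0 mulr1.
by rewrite -pmulrn subrr.
Qed.

Lemma rep_pow d f F k : represents d f F -> represents (k%:Z * d) (f ^+ k) (xypow F k).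
Proof.
move=> Ff; elim: k => [|k IH].
  by rewrite mul0r expr0; have := rep_const 0 1; rewrite expr0 mul1r.
rewrite exprS; have -> : k.+1%:Z * d = d + k%:Z * d by lia.
exact: rep_mul.
Qed.

Lemma rep_y_plus (b : R[i]) : represents 0 ('X + ('X * b%:P)%:P) (y_plus b).
Proof.
have [H1 H2] := rep_monom 0 1 0 1; have [K1 K2] := rep_monom 0 b 1 0.
rewrite expr0 !mul1r expr1 sub0r oppr0 in H1 H2.
rewrite expr0 !mulr1 expr1 sub0r in K1 K2.
split=> [i j|j q]; rewrite /y_plus; first by rewrite H1 K1 !coefD.
have [e|e _] := eqVneq (xymonom (1 : R[i]) 0 1%Z j q) 0; last exact: (H2 _ _ e).
by rewrite [X in X + _]e add0r => e'; exact: (K2 _ _ e').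
Qed.

Lemma rep_of_xseries d f F k : represents d f F ->
  represents d (f`_k)%:P (of_xseries (F k%:Z)).
Proof.
move=> [Ff F0]; split=> [i j|j q]; rewrite /of_xseries.
  by rewrite coefC eqz_nat; case: eqP; rewrite ?Ff ?coef0.
case: ifP => [/eqP -> /F0[i [j' [_ ->]]]|_]; last by rewrite eqxx.
by exists i, 0%N.
Qed.

Lemma rep_subst d f F g G : represents d f F -> represents 0 g G ->
  represents d (f \Po g) (subst_y F G).
Proof.
move=> Ff Gg.
have term k : represents d ((f`_k)%:P * g ^+ k)
    (xymul (of_xseries (F k%:Z)) (xypow G k)).
  rewrite -[d]addr0; apply: rep_mul; first exact: rep_of_xseries.
  by have := rep_pow k Gg; rewrite mulr0.
have fin j q k : (size f <= k)%N -> xymul (of_xseries (F k%:Z)) (xypow G k) j q = 0.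
  move=> sk; apply/eqP/negPn/negP => T0; have [TE /(_ _ _ T0)[i [j' [jE qE]]]] := term k.
  by move: T0; rewrite jE qE TE (nth_default 0 sk) mul0r !coef0 eqxx.
have substE j q : subst_y F G j q =
    \sum_(k < size f) xymul (of_xseries (F k%:Z)) (xypow G k) j q.
  rewrite /subst_y (@fsum_inj _ id (size f)) // => k Tk; exists k => //.
  by rewrite ltnNge; apply: contraNN Tk => /(fin j q) ->.
split=> [i j|j q]; rewrite substE.
  rewrite comp_polyE !coef_sum; apply: eq_bigr => k _.
  by have [-> _] := term k; rewrite mul_polyC.
move=> S0; have [k Tk] : exists k, xymul (of_xseries (F k%:Z)) (xypow G k) j q != 0.
  apply/not_existsP => H; move/eqP: S0; apply; apply: big1 => k _.
  by apply/eqP/negPn/negP; exact: H.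
by have [_] := term k; exact.
Qed.

Lemma rep_laurent d f F : represents d f F -> is_xlaurent_ypoly F.
Proof.
move=> [Ff F0]; split=> [|j q /F0[i [j' [-> ->]]]]; last first.
  by split=> //; rewrite rpredB ?rpred_int ?rpred_nat.
apply: (@sub_finite_set _ _ [set` [seq (j%:Z, d%:~R - i%:R : rat) |
   j <- iota 0 (size f), i <- iota 0 (size f`_j)]]); last exact: finite_seq.
move=> [j q] /= Fj; have [i [j' [jE qE]]] := F0 _ _ Fj.
rewrite jE qE Ff in Fj *; apply/allpairsPdep; exists j', i; split=> //.
  rewrite mem_iota /= add0n ltnNge; apply: contraNN Fj => /(nth_default 0) ->.
  by rewrite coef0.
by rewrite mem_iota /= add0n ltnNge; apply: contraNN Fj => /(nth_default 0) ->.
Qed.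

(** d0 bounds the absolute values of the exponents of x. The freedom to enlarge d serves to make it
    positive. *)
Lemma laurent_rep F : is_xlaurent_ypoly F ->
  exists d0 : nat, forall d : nat, (d0 <= d)%N -> exists f, represents d f F.
Proof.
move=> [/finite_seqP[s sE] FL].
have sP j q : F j q != 0 -> (j, q) \in s.
  by move=> Fj; have : [set` s] (j, q) by rewrite -sE.
pose Q := \max_(jq <- s) `|numq jq.2|%N; pose J := \max_(jq <- s) `|jq.1|%N.
exists Q => d Qd.
have FP j q : F j q != 0 -> exists2 i : nat, (i <= d + Q)%N &
    exists2 j' : nat, (j' <= J)%N & j = j'%:Z /\ q = d%:Z%:~R - i%:R.
  move=> Fj; have [j0 qi] := FL _ _ Fj; have jq := sP _ _ Fj.
  have qQ : (`|numq q| <= Q)%N.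
    exact: (@leq_bigmax_seq _ s xpredT (fun jq : int * rat => `|numq jq.2|%N) (j, q)).
  have jJ : (`|j| <= J)%N.
    exact: (@leq_bigmax_seq _ s xpredT (fun jq : int * rat => `|jq.1|%N) (j, q)).
  move: qi => /intrP[z zE]; rewrite zE numq_int in qQ.
  exists `|d%:Z - z|%N; first by lia.
  exists `|j|%N => //; split; first by rewrite gez0_abs.
  rewrite zE pmulrn gez0_abs; last by lia.
  by rewrite rmorphB /= subKr.
exists (\poly_(j < J.+1) \poly_(i < (d + Q).+1) F j%:Z (d%:Z%:~R - i%:R)).
split=> [i j|j q /FP[i _ [j' _ [-> ->]]]]; last by exists i, j'.
rewrite coef_poly ltnS; case: leqP => [jJ|Jj].
  rewrite coef_poly ltnS; case: leqP => // di.
  apply/eqP/negPn/negP => /FP[i' i'd [j' _ [_ /eqP]]].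
  rewrite (inj_eq (addrI _)) eqr_opp eqr_nat => /eqP ii'.
  by rewrite ii' ltnNge i'd in di.
rewrite coef0; apply/eqP/negPn/negP => /FP[i' _ [j' j'J [[jj'] _]]].
by rewrite jj' ltnNge j'J in Jj.
Qed.

(** * Degrees *)

Lemma degxP a (D : rat) : degx a = D%:E <->
  a D != 0 /\ forall q, a q != 0 -> q <= D.
Proof.
rewrite /degx; split=> [|[aD Dmax]]; last first.
  apply: xget_unique; first by exists D.
  move=> _ [D' [aD' D'max] <-]; congr (_%:E).
  by apply/le_anti; rewrite Dmax // D'max.
by case: xgetP => // x _ [D' [aD' D'max] <-] [<-].
Qed.

Lemma degx_le a (D : rat) : (forall q, a q != 0 -> q <= D) -> (degx a <= D%:E)%E.
Proof.
rewrite /degx => H; case: xgetP => [x _ [D' [aD' _] <-]|_]; last exact: leNye.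
by rewrite lee_fin H.
Qed.

(** A nonzero represented row attains its largest exponent, at the least i; this rules out the
    default value -oo of [degx]. *)
Lemma rep_degx_le d f F (j : int) (D q : rat) : represents d f F ->
  (degx (F j) <= D%:E)%E -> F j q != 0 -> q <= D.
Proof.
move=> [Ff F0] degD Fj; have [i [j' [jE qE]]] := F0 _ _ Fj.
rewrite jE in degD Fj *.
have ex : exists i, (f`_j')`_i != 0 by exists i; rewrite -Ff -qE.
case: (ex_minnP ex) => i0 fi0 i0min.
have degE : degx (F j'%:Z) = (d%:~R - i0%:R)%:E.
  apply/degxP; split=> [|q' Fq']; first by rewrite Ff.
  have [i1 [j1 [j1E q'E]]] := F0 _ _ Fq'; rewrite q'E lerD2l lerN2 ler_nat.
  by apply: i0min; rewrite -Ff -q'E.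
rewrite degE lee_fin in degD; apply: le_trans degD.
by rewrite qE lerD2l lerN2 ler_nat i0min // -Ff -qE.
Qed.

Lemma rep_row0 d f F (j : nat) : represents d f F -> F j%:Z = (fun=> 0) <-> f`_j = 0.
Proof.
move=> [Ff F0]; split=> [Fj|fj].
  by apply/polyP => i; rewrite -Ff Fj coef0.
apply/funext => q; apply/eqP/negPn/negP => Fj.
have [i [j' [[jE] qE]]] := F0 _ _ Fj.
by move: Fj; rewrite qE Ff fj coef0 eqxx.
Qed.

Lemma rep_row d f f' F F' (j : nat) : represents d f F -> represents d f' F' ->
  f`_j = f'`_j -> F j%:Z = F' j%:Z.
Proof.
move=> rF rF' fj; have /(rep_row0 j)[_] := rep_sub rF rF'.
rewrite coefB fj subrr => /(_ erefl) /(congr1 (fun a => a _)) E; apply/funext => q.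
by apply/eqP; rewrite -subr_eq0; apply/eqP; exact: E.
Qed.

Lemma rep_degy d f F : represents d f F -> f != 0 -> degy F = (size f).-1%:Z.
Proof.
move=> rF f0; have lf : f`_(size f).-1 != 0 by rewrite -lead_coefE lead_coef_eq0.
have top (j : int) : (size f).-1%:Z < j -> F j = (fun=> 0).
  case: j => [j|//] fj; apply/(rep_row0 _ rF); rewrite nth_default //.
  have sf : (0 < size f)%N by rewrite size_poly_gt0.
  by rewrite -(prednK sf); move: fj; rewrite ltz_nat.
apply: xget_unique => [|m [Fm Fgt]].
  by split=> [/(rep_row0 _ rF)/eqP|//]; rewrite (negbTE lf).
apply/le_anti/andP; split; rewrite leNgt; apply/negP.
  by move=> /top.
by move=> /Fgt /(rep_row0 _ rF)/eqP; rewrite (negbTE lf).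
Qed.

Lemma rep_neq0 d f F : represents d f F -> F <> (fun=> fun=> 0) -> f != 0.
Proof.
move=> rF F0; apply: contra_not_neq F0 => f0; apply/funext => j; apply/funext => q.
apply/eqP/negPn/negP => Fj; have [_ /(_ _ _ Fj) [i [j' [jE qE]]]] := rF.
by have [Ff _] := rF; move: Fj; rewrite jE qE Ff f0 !coef0 eqxx.
Qed.

(** Multiplied by N, the degree inequality for row k = m - j is the corner inequality. *)
Lemma corner_of_slope d f F (m l N : nat) (m0 : rat) : (0 < N)%N ->
  represents d f F -> f != 0 -> degy F = m -> degx (ycoef F 0) = m0%:E ->
  ycoef F 0 m0 = 1 ->
  (forall k : nat, (degx (ycoef F k) <= degx (ycoef F 0) +
     (- (l%:R / N%:R) * k%:R)%:E)%E) ->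
  exists i : nat, m0 = d%:~R - i%:R /\ corner N l m i f.
Proof.
move=> N0 rF f0 dF degF F1 slope; have [Ff F0] := rF.
have ycE k : ycoef F k = F (m%:Z - k%:Z) by rewrite /ycoef dF.
have [i [m' [mE m0E]]] : exists i j' : nat, m%:Z = j'%:Z /\ m0 = d%:~R - i%:R.
  by apply: F0; rewrite -[m%:Z]subr0 -ycE F1 oner_neq0.
have szf : size f = m.+1.
  have := rep_degy rF f0; rewrite dF => -[->]; rewrite prednK //.
  by rewrite size_poly_gt0.
exists i; split=> //; split=> [i' j fj||j mj].
- have jm : (j <= m)%N.
    by rewrite -ltnS -szf ltnNge; apply: contraNN fj => /(nth_default 0) ->; rewrite coef0.
  have := slope (m - j)%N; rewrite degF -EFinD => /(rep_degx_le rF).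
  rewrite dF; have -> : m%:Z - (m - j)%N%:Z = j%:Z by lia.
  move=> /(_ (d%:~R - i'%:R)); rewrite Ff fj => /(_ isT).
  rewrite m0E natrB // => H.
  have N0' : (0 : rat) < N%:R by rewrite ltr0n.
  have : (i%:R + l%:R / N%:R * (m%:R - j%:R) <= i'%:R :> rat) by lra.
  rewrite mulrAC -lerBrDl ler_pdivrMr // => {}H.
  have : (N * i + l * m)%N%:R <= (N * i' + l * j)%N%:R :> rat.
    by rewrite !natrD !natrM; lra.
  by rewrite ler_nat.
- by rewrite -Ff -m0E -[m%:Z]subr0 -ycE.
- by apply: nth_default; rewrite szf.
Qed.

Lemma prime_degreeP F (p : rat) : prime_degree F = p%:E -> is_prime_degree F p.
Proof.
rewrite /prime_degree; case: asboolP => // _.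
by case: xgetP => // x _ [p' pF <-] [<-].
Qed.

(** If the prime degree is -oo, all rows below the top are zero and have degree -oo; the default +oo
    is excluded by the bound. *)
Lemma prime_degree_le F (p : rat) : (prime_degree F <= p%:E)%E ->
  degx (ycoef F 0) \is a fin_num ->
  forall k : nat, (degx (ycoef F k) <= degx (ycoef F 0) + (p * k%:R)%:E)%E.
Proof.
rewrite /prime_degree; case: asboolP => [F0 _ fin k|_].
  case: k => [|k]; first by rewrite mulr0 adde0.
  rewrite F0 // [degx (fun=> 0)](_ : _ = -oo%E) ?leNye //.
  by rewrite /degx; case: xgetP => // x _ [D [/eqP]].
case: xgetP => [x _ [p' [slope _] <-]|_]; last by rewrite leye_eq.
rewrite lee_fin => pp' fin k; apply: le_trans (slope k) _.
by rewrite leeD2lE // lee_fin ler_wpM2r.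
Qed.

(** The row where the prime degree is attained supplies a second point on the leading edge. *)
Lemma edge_point d f F (m l N i : nat) (m0 : rat) : (0 < N)%N ->
  represents d f F -> degy F = m -> degx (ycoef F 0) = m0%:E ->
  m0 = d%:~R - i%:R -> is_prime_degree F (- (l%:R / N%:R)) ->
  exists i' j', [/\ (j' < m)%N, (f`_j')`_i' != 0 & (N * i' + l * j' = N * i + l * m)%N].
Proof.
move=> N0 rF dF degF m0E [_ [k [k0]]]; have [Ff F0] := rF.
rewrite degF -EFinD => /degxP[]; rewrite /ycoef dF => Fk _.
have [i' [j' [jE qE]]] := F0 _ _ Fk; exists i', j'.
have mE : m = (j' + k)%N by lia.
split; first by lia.
  by rewrite -Ff -qE -jE.
have N0' : (N%:R : rat) != 0 by rewrite pnatr_eq0 -lt0n.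
have : i'%:R = i%:R + l%:R * k%:R / N%:R :> rat.
  by move: qE; rewrite m0E mulrAC; lra.
move/(congr1 ( *%R N%:R)); rewrite mulrDr [_ * (_ / _)]mulrC divfK // => E.
by apply/eqP; rewrite -(eqr_nat rat) mE !natrD !natrM natrD E; apply/eqP; ring.
Qed.

(** -p is the least of the finitely many slopes (m0 - q) / (m - j) over the support points x^q y^j
    below the top row; row j0 provides at least one. *)
Lemma prime_degree_exists d f F (m j0 : nat) (m0 : rat) :
  represents d f F -> degy F = m -> degx (ycoef F 0) = m0%:E ->
  (j0 < m)%N -> f`_j0 != 0 ->
  exists p, prime_degree F = p%:E /\ is_prime_degree F p.
Proof.
move=> rF dF degF j0m fj0; have [Ff F0] := rF.
have ycE k : ycoef F k = F (m%:Z - k%:Z) by rewrite /ycoef dF.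
suff [p pF] : exists p, is_prime_degree F p.
  rewrite /prime_degree; case: asboolP => [H|_].
    have /H : (0 < m - j0)%N by rewrite subn_gt0.
    rewrite ycE; have -> : m%:Z - (m - j0)%N%:Z = j0%:Z by lia.
    by move/(rep_row0 _ rF)/eqP; rewrite (negbTE fj0).
  case: xgetP => [x _ [p' p'F <-]|/(_ p%:E)]; first by exists p'.
  by case; exists p.
pose s i j : rat := (m0 - (d%:~R - i%:R)) / (m - j)%:R.
pose r j := [seq s i j | i <- iota 0 (size f`_j) & (f`_j)`_i != 0].
pose L := flatten [seq r j | j <- iota 0 m].
have LP z : reflect (exists i j, [/\ (j < m)%N, (f`_j)`_i != 0 & z = s i j]) (z \in L).
  apply: (iffP flatten_mapP) => [[j]|[i [j [jm fij ->]]]].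
    rewrite mem_iota add0n /= => jm.
    by case/mapP => i; rewrite mem_filter => /andP[fij _] ->; exists i, j.
  exists j; first by rewrite mem_iota.
  apply/mapP; exists i => //; rewrite mem_filter fij mem_iota add0n /=.
  by rewrite ltnNge; apply: contraNN fij => /(nth_default 0) ->.
have Ls : s (size f`_j0).-1 j0 \in L.
  by apply/LP; exists (size f`_j0).-1, j0; rewrite -lead_coefE lead_coef_eq0.
case LE : L Ls => [|x t] // _; have [z] := seq_min x t; rewrite -LE => zL zmin.
have key i j : (j < m)%N -> (f`_j)`_i != 0 -> d%:~R - i%:R <= m0 - z * (m - j)%:R.
  move=> jm fij; have /zmin : s i j \in L by apply/LP; exists i, j.
  by rewrite /s ler_pdivlMr ?ltr0n ?subn_gt0 // => H; lra.
have bound k q : (0 < k)%N -> ycoef F k q != 0 -> q <= m0 - z * k%:R.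
  rewrite ycE => k0 Fq; have [i [j [jE qE]]] := F0 _ _ Fq.
  have -> : k = (m - j)%N by lia.
  by rewrite qE; apply: key; [lia|rewrite -Ff -qE -jE].
exists (- z); split.
  case=> [|k]; first by rewrite mulr0 adde0.
  by rewrite degF -EFinD mulNr; apply: degx_le => q; exact: bound.
have /LP[i [j [jm fij zE]]] := zL; exists (m - j)%N; rewrite subn_gt0; split=> //.
rewrite degF -EFinD mulNr; apply/degxP; split; last first.
  by move=> q; apply: bound; rewrite subn_gt0.
have -> : m0 - z * (m - j)%:R = d%:~R - i%:R.
  by rewrite zE /s divfK ?subKr // pnatr_eq0 subn_eq0 -ltnNge.
rewrite ycE; have -> : m%:Z - (m - j)%N%:Z = j%:Z by lia.
by rewrite Ff.
Qed.

(** * From Jacobi pairs to corners and residues *)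

Lemma xypoly_laurent F : is_xypoly F -> is_xlaurent_ypoly F.
Proof.
by move=> [fin H]; split=> // j q /H[j0 /natrP[k ->]]; rewrite j0 rpred_nat.
Qed.

Lemma jacobi_corners F G (m0 p : rat) (l N : nat) : (0 < N)%N ->
  jacobi_pair F G -> is_xlaurent_ypoly F -> is_xlaurent_ypoly G ->
  degx (ycoef F 0) = m0%:E -> prime_degree F = p%:E -> p = - (l%:R / N%:R) ->
  xmonic (ycoef F 0) -> xmonic (ycoef G 0) ->
  exists (m n d e i j : nat) f g (c : R[i]),
    [/\ represents d f F, represents e g G, degy F = m & degy G = n] /\
    [/\ m0 = d%:R - i%:R, corner N l m i f, corner N l n j g & (0 < d + e)%N] /\
    [/\ br d e f g = (c *: 'X^((d + e).-1))%:P, c != 0 & is_prime_degree F p].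
Proof.
move=> N0 [_ [F0 G0] [c [c0 brc]] _ pG] FL GL degF pF pE [m1 [m1E F1]] [n0 [n0E G1]].
(* d >= 1 ensures that the natural number (d + e).-1 is really d + e - 1. *)
have [d1 /(_ (maxn d1 1)) [|f rF]] := laurent_rep FL; first exact: leq_maxl.
have [e /(_ e (leqnn e))[g rG]] := laurent_rep GL.
set d := maxn d1 1 in rF; have d0 : (0 < d)%N by rewrite leq_max orbT.
have f0 := rep_neq0 rF F0; have g0 := rep_neq0 rG G0.
have dF := rep_degy rF f0; have dG := rep_degy rG g0.
have pF' := prime_degreeP pF.
have m1m : m1 = m0 by move: m1E; rewrite degF => -[->].
have [i [m0E cf]] : exists i : nat, m0 = d%:R - i%:R /\ corner N l (size f).-1 i f.
  apply: (corner_of_slope N0 rF f0 dF degF) => [|k]; first by rewrite -m1m.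
  by rewrite -pE; case: pF' => /(_ k).
have [j [_ cg]] : exists j : nat, n0 = e%:R - j%:R /\ corner N l (size g).-1 j g.
  apply: (corner_of_slope N0 rG g0 dG n0E G1) => k; rewrite -pE.
  by apply: prime_degree_le; rewrite -?pF // n0E.
exists (size f).-1, (size g).-1, d, e, i, j, f, g, c; split=> //; split; split=> //.
  by rewrite addn_gt0 d0.
apply: (rep_inj (rep_bracket rF rG)); rewrite brc.
have -> : d%:Z + e%:Z - 1 = (d + e).-1%:Z by lia.
by rewrite -mul_polyC mulrC; exact: rep_const.
Qed.

(** The product has degree d + e - 1 split off, so x^(-1) corresponds to u^(d+e); the sign comes
    from exchanging F and G. *)
Lemma rep_residue (d e : nat) f g F G : represents d f F -> represents e g G ->
  (0 < d + e)%N ->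
  resx (xymul F (ddx G)) 0 = - ares d (d + e) f`_0 g`_0.
Proof.
move=> rF rG de; have [E _] := rep_mul rF (rep_ddx rG).
have := E (d + e)%N 0%N; rewrite /resx.
have -> : (d%:Z + (e%:Z - 1))%:~R - (d + e)%:R = -1 :> rat.
  by rewrite !intrD -!pmulrn natrD; ring.
move=> ->; rewrite -(ares_swap _ _ (erefl (d + e)%N)) /ares coef0M coefB coef_theta.
by rewrite -(rmorph_int (@polyC {poly R[i]})) coefCM.
Qed.

Lemma rep_poly_size (d : nat) f F : represents d f F -> is_xypoly F ->
  (size (f`_0)%R <= d.+1)%N.
Proof.
move=> [Ff _] [_ FP]; apply/leq_sizeP => i di; rewrite -Ff.
apply/eqP/negPn/negP => /FP[_ /natrP[k kE]].
have : d%:R = (i + k)%N%:R :> rat by rewrite natrD -kE -pmulrn; ring.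
by move/eqP; rewrite eqr_nat; lia.
Qed.

(** With x^m0, m0 = d - i, split off, both sides become (y - z u)^m, whose coefficient at y^j is a
    single monomial in u. *)
Lemma lead_component_slope_one (d i m : nat) f F (z : R[i]) : represents d f F ->
  degy F = m -> degx (ycoef F 0) = (d%:R - i%:R : rat)%:E -> prime_degree F = (-1)%:E ->
  (i <= d)%N -> corner 1 1 m i f ->
  (forall i' j', (i' + j' = i + m)%N -> (f`_j')`_i' = (('X - z%:P) ^+ m)`_j') ->
  lead_component F =
    xymul (xymonom 1 (d%:R - i%:R) 0) (xypow (y_plus (- z)) m).
Proof.
move=> rF dF degF pF id [_ _ fgt] fE; have [Ff F0] := rF.
apply: (@rep_ext (d - i)%N%:Z (('X + ('X * (- z)%:P)%:P) ^+ m)); last first.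
  rewrite -[(d - i)%N%:Z]addr0 -[X in represents _ X]mul1r; apply: rep_mul.
    have := rep_monom (d - i)%N%:Z (1 : R[i]) 0 0; rewrite !expr0 !mulr1 subr0.
    by rewrite -pmulrn natrB.
  by have := rep_pow m (rep_y_plus (- z)); rewrite mulr0.
have big j : (m < j)%N -> (('X - z%:P : {poly R[i]}) ^+ m)`_j = 0.
  by move=> mj; rewrite nth_default // size_exp_XsubC.
split=> [i' j'|j q]; rewrite /lead_component dF degF pF /=.
  rewrite coef_shift_exp polyCN coefMC coefXn.
  have [jm|mj] := leqP j' m; last first.
    by rewrite (big _ mj) mulr0; case: ifP => // /andP[]; lia.
  have -> : (0 <= m%:Z - j'%:Z) = true by lia.
  have -> : ((d - i)%N%:Z%:~R - i'%:R == d%:R - i%:R + (m%:Z - j'%:Z)%:~R * (-1) :> rat)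
      = (i' == m - j')%N.
    rewrite -pmulrn natrB // rmorphB /= -!pmulrn -(eqr_nat rat) natrB //.
    by apply/eqP/eqP; lra.
  case: eqP => [iE|_]; rewrite ?mul0r // mul1r /=.
  have -> : (d - i)%N%:Z%:~R - i'%:R = d%:Z%:~R - (i + i')%N%:R :> rat.
    by rewrite -pmulrn natrB // natrD -pmulrn; ring.
  by rewrite Ff (fE (i + i')%N) // iE -addnA subnK.
case: ifP => [/andP[mj /eqP qE] /F0[i1 [j' [jE _]]]|_]; last by rewrite eqxx.
exists (m - j')%N, j'; split=> //; rewrite qE jE.
have jm : (j' <= m)%N by lia.
by rewrite -pmulrn !natrB // rmorphB /= -!pmulrn; ring.
Qed.

(** * The pair after the shift *)

Lemma size_shift b f : size (f \Po ('X + ('X * b%:P)%:P : {poly {poly R[i]}})) = size f.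
Proof. by rewrite size_comp_poly2 // size_XaddC. Qed.

Lemma rep_shift d f F b : represents d f F ->
  represents d (f \Po ('X + ('X * b%:P)%:P)) (subst_y F (y_plus b)).
Proof. by move=> rF; apply: rep_subst rF (rep_y_plus b). Qed.

Lemma shift_top d f F b : represents d f F -> f != 0 ->
  degy (subst_y F (y_plus b)) = degy F /\ ycoef (subst_y F (y_plus b)) 0 = ycoef F 0.
Proof.
move=> rF f0; have rF' := rep_shift b rF.
have f'0 : f \Po ('X + ('X * b%:P)%:P) != 0 by rewrite -size_poly_eq0 size_shift size_poly_eq0.
have dE : degy (subst_y F (y_plus b)) = degy F.
  by rewrite (rep_degy rF' f'0) (rep_degy rF f0) size_shift.
split=> //; rewrite /ycoef dE (rep_degy rF f0) subr0; apply: rep_row rF' rF _.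
have := @lead_coef_comp _ f ('X + ('X * b%:P)%:P).
rewrite size_XaddC lead_coefDl ?size_polyX ?lead_coefX ?expr1n ?mulr1; last first.
  by rewrite ltnS size_polyC leq_b1.
by move=> /(_ isT); rewrite !lead_coefE size_shift.
Qed.

Lemma shift_pair (d e : int) f g F G b P : represents d f F -> represents e g G ->
  f != 0 -> g != 0 -> br d e f g = P%:P ->
  let F' := subst_y F (y_plus b) in let G' := subst_y G (y_plus b) in
  [/\ is_xlaurent_ypoly F' /\ is_xlaurent_ypoly G',
      degy F' = degy F /\ degy G' = degy G,
      ycoef F' 0 = ycoef F 0 /\ ycoef G' 0 = ycoef G 0 &
      bracket F' G' = bracket F G].
Proof.
move=> rF rG f0 g0 brE; have rF' := rep_shift b rF; have rG' := rep_shift b rG.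
have [dF tF] := shift_top b rF f0; have [dG tG] := shift_top b rG g0.
split=> //; first by split; [exact: rep_laurent rF'|exact: rep_laurent rG'].
apply: rep_ext (rep_bracket rF' rG') _.
by rewrite br_comp brE comp_polyC -brE; exact: rep_bracket.
Qed.

Lemma subst_y0 d f F : represents d f F -> subst_y F (y_plus 0) = F.
Proof.
move=> rF; apply: rep_ext (rep_shift 0 rF) _.
by rewrite polyC0 mulr0 polyC0 addr0 comp_polyXr.
Qed.

End Representation.

(** * The polynomial case and the Laurent case *)

Theorem theorem3p25 (R : realType) (F G : xyseries R) (m n : int) (m0 p : rat)
  (hFG : jacobi_pair F G)
  (hm : degy F = m) (hn : degy G = n)
  (hm0 : degx (ycoef F 0) = m0%:E) (hp : prime_degree F = p%:E)
  (m0_ge0 : 0 <= m0)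
  (f0_monic : xmonic (ycoef F 0)) (g0_monic : xmonic (ycoef G 0))
  (hpm : p != - (m0 / m%:~R))
  (m_ge2 : 2 <= m) (mn_ge2 : 2 <= m + n) :
  (is_xypoly F -> is_xypoly G -> p != - 1)
  /\
  (is_xlaurent_ypoly F -> is_xlaurent_ypoly G -> m%:~R < m0 -> p < 0 ->
   [/\ p <= - 1,
       p = - 1 ->
         resx (xymul F (ddx G)) <> (fun=> 0) /\
         (exists b : R[i], b != 0 /\
            lead_component F =
              xymul (xymonom 1 m0 0) (xypow (y_plus (- b)) `|m|%N))
     & exists b : R[i],
         let F' := subst_y F (y_plus b) in
         let G' := subst_y G (y_plus b) in
         [/\ is_xlaurent_ypoly F' /\ is_xlaurent_ypoly G',
             degy F' = m /\ degy G' = n,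
             ycoef F' 0 = ycoef F 0 /\ ycoef G' 0 = ycoef G 0,
             bracket F' G' = bracket F G
           & exists p' : rat, prime_degree F' = p'%:E /\ p' < - 1]]).
Proof.
have slope1 : p = -1 -> p = - (1%:R / 1%:R) by rewrite divr1.
split=> [FP GP|FL GL mm0 p0].
  apply/eqP => p1; have FL := xypoly_laurent FP; have GL := xypoly_laurent GP.
  have [m' [n' [d [e [i [j [f [g [c [[rF rG dF dG] [[m0E cf cg de] [brE c0 pF]]]]]]]]]]]] :=
    jacobi_corners (ltn0Sn 0) hFG FL GL hm0 hp (slope1 p1) f0_monic g0_monic.
  have mE : m = m' by rewrite -hm.
  have m'1 : (1 < m')%N by rewrite mE in m_ge2.
  have pF1 : is_prime_degree F (- (1%:R / 1%:R)) by rewrite -slope1.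
  have [i' [j' [j'm fj ij]]] := edge_point (ltn0Sn 0) rF dF hm0 m0E pF1.
  rewrite !mul1n in ij.
  (* Equality would mean m0 = m, so that p = -1 = -m0/m, which is excluded. *)
  have dim : (i + m' != d)%N.
    apply: contra_neq hpm => dE; rewrite p1 m0E -dE natrD addrC addKr mE.
    by rewrite -pmulrn divff // pnatr_eq0 -lt0n ltnW.
  (* The residue is nonzero on an edge with p = -1, but it is 0 for polynomials. *)
  have [+ _] := slope_one_edge m'1 de dim cf cg brE c0 j'm fj ij.
  by rewrite ares_poly ?eqxx // ?(rep_poly_size rF) ?(rep_poly_size rG).
have one : p = -1 -> exists (m' n' d e i j : nat) f g (z c : R[i]),
    [/\ represents d f F, represents e g G, m = m' & n = n'] /\
    [/\ m0 = d%:R - i%:R, corner 1 1 m' i f, (0 < d + e)%N & z != 0] /\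
    [/\ br d e f g = (c *: 'X^((d + e).-1))%:P /\ c != 0, (1 < m')%N,
        ares d (d + e) f`_0 g`_0 != 0 &
        forall i' j', (i' + j' = i + m')%N -> (f`_j')`_i' = (('X - z%:P) ^+ m')`_j'].
  move=> p1.
  have [m' [n' [d [e [i [j [f [g [c [[rF rG dF dG] [[m0E cf cg de] [brE c0 pF]]]]]]]]]]]] :=
    jacobi_corners (ltn0Sn 0) hFG FL GL hm0 hp (slope1 p1) f0_monic g0_monic.
  have mE : m = m' by rewrite -hm.
  have nE : n = n' by rewrite -hn.
  have m'1 : (1 < m')%N by rewrite mE in m_ge2.
  have pF1 : is_prime_degree F (- (1%:R / 1%:R)) by rewrite -slope1.
  have [i' [j' [j'm fj ij]]] := edge_point (ltn0Sn 0) rF dF hm0 m0E pF1.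
  rewrite !mul1n in ij.
  have dim : (i + m' != d)%N.
    apply: contraTneq mm0 => dE; rewrite m0E -dE natrD addrC addKr mE.
    by rewrite -pmulrn ltxx.
  have [A0 [z z0 fE]] := slope_one_edge m'1 de dim cf cg brE c0 j'm fj ij.
  by exists m', n', d, e, i, j, f, g, z, c.
have ple : p <= -1.
  rewrite leNgt; apply/negP => p1.
  have [|l [N [l0 N0 _ lN]]] := @rat_slope (- p); first by rewrite oppr_gt0.
  have pE : p = - (l%:R / N%:R) by rewrite -lN opprK.
  have [m' [n' [d [e [i [j [f [g [c [[rF rG dF dG] [[m0E cf cg de] [brE c0 pF]]]]]]]]]]]] :=
    jacobi_corners N0 hFG FL GL hm0 hp pE f0_monic g0_monic.
  have mE : m = m' by rewrite -hm.
  have m'1 : (1 < m')%N by rewrite mE in m_ge2.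
  rewrite pE in pF.
  have [i' [j' [j'm fj ij]]] := edge_point N0 rF dF hm0 m0E pF.
  apply: (no_shallow_edge l0 _ m'1 _ cf cg brE c0 j'm fj ij).
    have : l%:R / N%:R < 1 :> rat by rewrite -lN; lra.
    by rewrite ltr_pdivrMr ?ltr0n // mul1r ltr_nat.
  move: mm0; rewrite mE m0E -pmulrn ltrBrDr -natrD ltr_nat.
  by rewrite addnC.
split=> // [p1|].
  have := one p1.
  move=> [m' [n' [d [e [i [j [f [g [z [c [[rF rG mE nE] [[m0E cf de z0] [[brE c0] m'1 A0 fE]]]]]]]]]]]]].
  split.
    move=> /(congr1 (fun r => r 0)); rewrite (rep_residue rF rG de) => /eqP.
    by rewrite oppr_eq0 (negbTE A0).
  exists z; split=> //; rewrite mE m0E absz_nat.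
  apply: (lead_component_slope_one rF _ _ _ _ cf fE).
  - by rewrite hm.
  - by rewrite -m0E.
  - by rewrite -p1.
  - by move: m0_ge0; rewrite m0E subr_ge0 ler_nat.
have [_ [F0 G0] _ _ _] := hFG.
(* If p < -1 already, the shift by 0 serves. *)
have [pE|p1] := eqVneq p (-1); last first.
  have plt : p < -1 by rewrite lt_neqAle p1.
  have [|l [N [l0 N0 _ lN]]] := @rat_slope (- p); first by rewrite oppr_gt0.
  have pE : p = - (l%:R / N%:R) by rewrite -lN opprK.
  have [m' [n' [d [e [i [j [f [g [c [[rF rG _ _] [_ [brE _ _]]]]]]]]]]]] :=
    jacobi_corners N0 hFG FL GL hm0 hp pE f0_monic g0_monic.
  exists 0; rewrite (subst_y0 rF) (subst_y0 rG); split=> //.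
  by exists p.
have := one pE.
move=> [m' [n' [d [e [i [j [f [g [z [c [[rF rG mE nE] [[m0E cf de z0] [[brE c0] m'1 A0 fE]]]]]]]]]]]]].
have f0 := rep_neq0 rF F0; have g0 := rep_neq0 rG G0.
(* Shifting by the root z of the edge polynomial clears the edge of slope -1 except for its
   corner. *)
exists z; have := shift_pair z rF rG f0 g0 brE; cbv zeta.
have rF' := rep_shift z rF; have rG' := rep_shift z rG.
set F' := subst_y F _ in rF' *; set G' := subst_y G _ in rG' *.
set f' := f \Po _ in rF'; set g' := g \Po _ in rG'.
move=> [LFG [dF' dG'] [tF' tG'] brFG]; split=> //; first by rewrite dF' dG'.
have brE' : br d e f' g' = (c *: 'X^((d + e).-1))%:P by rewrite br_comp brE comp_polyC.
have cX0 : c *: 'X^((d + e).-1) != 0 :> {poly R[i]}.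
  by rewrite scaler_eq0 negb_or c0 expf_neq0 // polyX_eq0.
have [j0 j02 fj0] := br_const_low brE' cX0.
have dFm : degy F' = m' by rewrite dF' hm.
have degF' : degx (ycoef F' 0) = m0%:E by rewrite tF'.
have [p' [p'E [_ [k [k0]]]]] :=
  prime_degree_exists rF' dFm degF' (leq_trans j02 m'1) fj0.
rewrite degF' -EFinD => /degxP[].
rewrite /ycoef dFm => F'k _; have [Ff' F0'] := rF'.
have [i' [j' [jE qE]]] := F0' _ _ F'k.
have kE : m' = (j' + k)%N by apply/eqP; rewrite -eqz_nat PoszD -jE subrK.
(* The point that realizes p' lies strictly above the old edge, hence p' < -1. *)
have : (i + m' < i' + j')%N.
  apply: (shift_edge cf fE); first by rewrite kE -[X in (X < _)%N]addn0 ltn_add2l.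
  by rewrite -Ff' -qE -jE.
rewrite kE -(ltr_nat rat) !natrD => H.
have k0' : (0 : rat) < k%:R by rewrite ltr0n.
exists p'; split=> //; have : p' * k%:R < -1 * k%:R by move: qE; rewrite m0E -pmulrn; lra.
by rewrite ltr_pM2r.
Qed.
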